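(* Let $n>k\ge1$ be coprime integers, $\ell\ge 1$, and $r,s\in\mathbb{Z}$ with $rn=ks+1$. Consider nonzero complex numbers $\varepsilon,b,\lambda_1,\dots,\lambda_\ell,\xi_1,\dots,\xi_{k+1}$ and set $$\eta_1:=(-1)^{k-1}\varepsilon^r\prod_{i=1}^{k}\xi_i^{-1},\qquad \eta_2:=(-1)^{k-1}\varepsilon^r b\prod_{i=1}^{k+1}\xi_i^{-1}.$$ Assume $\lambda_1,\dots,\lambda_\ell,\eta_1,\eta_2\ne1$; $\lambda_1,\dots,\lambda_\ell\neq\eta_1$; $\xi_i\ne\xi_j$ for $i\ne j$; $\xi_1,\dots,\xi_{k+1}\ne b$; $\xi_1^k,\dots,\xi_{k+1}^k,b^k\ne\varepsilon^r$; $\sum_{i=1}^k\xi_i\ne0$; $\eta_1\neq\eta_2$; and the Fuchs relation $$\lambda_1\cdots\lambda_\ell\,\xi_1^\ell\cdots\xi_k^\ell\,\xi_{k+1}=(-1)^{(k-1)\ell}\,b\,\varepsilon^{r\ell}.$$ Then: (i) There is an irreducible rigid Pochhammer local system $\mathcal{F}$ of multiplicity one on $T_{n,k,\bullet}$ determined by the numerical local data $(\varepsilon;\eta_1;\xi_1,\dots,\xi_k)$. (ii) There is an irreducible rigid Pochhammer local system $\mathcal{G}^*$ of multiplicity one on $T^*_{n,k,\bullet}$ determined by the numerical local data $(\varepsilon;b;\eta_2;\xi_1,\dots,\xi_{k+1})$. (iii) There is an irreducible rigid Pochhammer local system $\widetilde{\mathcal{L}}$ of multiplicity one on $D'_\bullet$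 determined by the numerical local data $(\lambda_1,\dots,\lambda_\ell;\eta_1,\eta_2)$. (iv) The tuple $(\varepsilon;b;\lambda_1,\dots,\lambda_\ell;\xi_1,\dots,\xi_{k+1};\ell,\dots,\ell,1)$ is the numerical local data of an irreducible rigid Pochhammer local system of multiplicity one on $T^*_{n,k,\ell}$ with semi-simple monodromy at $\infty$, obtained as an extension of $\mathcal{F}^{\oplus(\ell-1)}|_{T^*_{n,k,\bullet}}\oplus\mathcal{G}^*$ via $\widetilde{\mathcal{L}}$. Moreover, this extension is unique (up to isomorphism).
   Context: Local systems are locally constant sheaves of finite-dimensional complex vector spaces; $\varrho$ denotes monodromy representation. A pseudo-reflection is an invertible matrix $M$ with $\mathrm{codim}\ker(M-\mathbf{I})=1$; its special eigenvalue is $\det M$, always assumed $\ne1$. Turbines. Let $C_1,\dots,C_\ell$ be distinct nonzero complex numbers, $Y_0=\{y=0\}$, $Y_i=\{y^k=C_ix^n\}$. For closed discs $D_{\rho_1},D_{\rho_2}\subset\mathbb{C}$ centered at $0$, $0<\rho_1\ll\rho_2$ suitable, let $N_\infty=\partial D_{\rho_1}\times D_{\rho_2}$, and let $N_0,\dots,N_\ell\subset\mathrm{int}(N_\infty)$ be disjoint thin closed tubular neighbourhoods of the knots $Y_i\cap\partial(D_{\rho_1}\times D_{\rho_2})$. $T^*_{n,k,\ell}=N_\infty\setminus\bigcup_{i=0}^\ell\mathrm{int}(N_i)$ (with shaft), $T_{n,k,\ell}=N_\infty\setminus\bigcup_{i=1}^\ell\mathrm{int}(N_i)$ (without shaft).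 With $\alpha_i,\beta_i$ the standard meridian and parallel of $\partial N_i$, and $\delta=\alpha_i^n\beta_i^k$, $\omega_i=\alpha_i^s\beta_i^r$ for $i=0,\infty$ (so $\alpha_i=\delta^r\omega_i^{-k}$), one has $\pi_1(T^*_{n,k,\ell})=\langle\alpha_1,\dots,\alpha_\ell,\omega_0,\omega_\infty:\alpha_1\cdots\alpha_\ell\omega_\infty=\omega_0\rangle\times\langle\delta\rangle$ ($\langle\delta\rangle$ infinite cyclic), and $\pi_1(T_{n,k,\ell})$ is the quotient by $\omega_0^k=\delta^r$. $\pi_1(\partial N_i)$ is generated by $\omega_i,\delta$ ($i=0,\infty$), resp. $\alpha_i,\delta$ ($1\le i\le\ell$). Let $N_\bullet$ be a solid torus with $N_i\subset N_\bullet\subset N_\infty\setminus N_0$ for $1\le i\le\ell$ such that $T^*_{n,k,\bullet}=N_\infty\setminus\mathrm{int}(N_0\cup N_\bullet)$ is a turbine with shaft and parameters $n,k,1$; $T_{n,k,\bullet}=N_\infty\setminus\mathrm{int}(N_\bullet)$ is the one without shaft. In them the role of ''$\alpha_1$'' is played by $\alpha_\bullet=\alpha_1\cdots\alpha_\ell$. $D_\bullet$ is a disc section transversal to $N_\bullet$, $D_i\subset D_\bullet$ disc sections of $N_i$, $D'_\bullet=D_\bullet\setminus\bigcup_{i=1}^\ell\mathrm{int}(D_i)$, so $\pi_1(D'_\bullet)$ is free on $\alpha_1,\dots,\alpha_\ell$ and the outer boundary $\partial D_\bullet$ is $\alpha_\bullet$. Rigidity. A local system on a turbine is rigid if it is determined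 up to isomorphism by its restrictions to the boundary tori ($\partial N_i$ for $i\in\{0,\dots,\ell,\infty\}$ with shaft, $i\in\{1,\dots,\ell,\infty\}$ without shaft). A local system on $D'_\bullet$ is rigid if it is determined up to isomorphism by its restrictions to $\partial D_1,\dots,\partial D_\ell,\partial D_\bullet$. Pochhammer. Let $U$ be a simply connected planar domain minus finitely many points (or discs), with $\pi_1(U)$ freely generated by simple loops $\gamma_1,\dots,\gamma_N$ around them. A local system on $U$ with fibre $V$ is Pochhammer if $\dim V=\sum_i\mathrm{codim}\,V^{\gamma_i}$ and $\bigcap_iV^{\gamma_i}=0$, where $V^{\gamma}=\ker(\varrho(\gamma)-1)$; it has multiplicity one if all $\mathrm{codim}\,V^{\gamma_i}=1$. A local system on a turbine is Pochhammer [of multiplicity one] if its restriction to the section $U$ of the turbine by a generic line ($x=$ const) is. For $T^*_{n,k,\ell}$ the loops are $\alpha_0$ and $\omega_0^{k-1-j}\alpha_i\omega_0^{1-k+j}$ ($0\le j\le k-1$, $1\le i\le\ell$); for $T_{n,k,\ell}$ omit $\alpha_0$. Semi-simple monodromy at $\infty$ means $\varrho(\omega_\infty)$ is semi-simple. Numerical local data. With shaft: $(\varepsilon;b;\lambda_1,\dots,\lambda_\ell;\xi_1,\dots,\xi_\nu;m_1,\dots,m_\nu)$ means $\varrho(\delta)=\varepsilon\mathbf{I}$; $\varrho(\alpha_i)$ is a pseudo-reflection with special eigenvalue $\lambda_i$ ($1\le i\le\ell$); $\varrho(\omega_0)$ is conjugate to $\zeta_1\mathbf{I}_\ell\oplus\cdots\oplus\zeta_k\mathbf{I}_\ell\oplus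 b$ with $\zeta_1,\dots,\zeta_k$ the $k$-th roots of $\varepsilon^r$; $\varrho(\omega_\infty)$ is conjugate to $\xi_1\mathbf{I}_{m_1}\oplus\cdots\oplus\xi_\nu\mathbf{I}_{m_\nu}$ with distinct $\xi_j$. Without shaft: $(\varepsilon;\lambda_1,\dots,\lambda_\ell;\xi_1,\dots,\xi_\nu;m_1,\dots,m_\nu)$ has the same meaning with $\varrho(\omega_0)$ conjugate to $\zeta_1\mathbf{I}_\ell\oplus\cdots\oplus\zeta_k\mathbf{I}_\ell$. Omitted $m_j$ are all equal to $1$. On $D'_\bullet$: $(\lambda_1,\dots,\lambda_\ell;\eta_1,\eta_2)$ means rank $\ell$, $\varrho(\alpha_i)$ a pseudo-reflection with special eigenvalue $\lambda_i$, and $\varrho(\alpha_\bullet)$ conjugate to $\eta_1\mathbf{I}_{\ell-1}\oplus\eta_2$. Extension. A Pochhammer local system $\mathcal{L}$ on $T^*_{n,k,\ell}$ is an extension of $\mathcal{L}'$ (Pochhammer on $T^*_{n,k,\bullet}$) via $\widetilde{\mathcal{L}}$ (Pochhammer on $D'_\bullet$) if $\mathcal{L}|_{T^*_{n,k,\bullet}}\simeq\mathcal{L}'$ and there is a constant subsheaf $\mathcal{K}\subset\mathcal{L}|_{D'_\bullet}$ with $\mathcal{L}|_{D'_\bullet}/\mathcal{K}\simeq\widetilde{\mathcal{L}}$. *)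

(* Defs.v *)
From HB Require Import structures.
From mathcomp Require Import all_boot all_order all_algebra.
From mathcomp Require Export reals.
From mathcomp Require Export complex.

Set Implicit Arguments.
Unset Strict Implicit.
Unset Printing Implicit Defensive.

Import Order.TTheory GRing.Theory Num.Theory.
Local Open Scope ring_scope.

(* A (connected) space enters only through the presentation of its fundamental
   group, and a local system is given by its monodromy representation, with
   fibre the space of column vectors of size d, on which matrices act from the
   left.  MathComp's subspaces are row spaces, so a subspace of column vectors
   is represented by a matrix U whose ROWS are the transposes of spanning
   vectors: v belongs to it when (v^T <= U)%MS. *)

(* The word [:: (g1, z1); (g2, z2); ...] stands for g1^z1 g2^z2 ...; the exponents
   may be negative. *)
Definition word (G : Type) : Type := seq (G * int).

Record presentation := Presentation {
  gen : Type;
  rel : word gen -> word gen -> Prop   (* the defining relations u = v *)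
}.

Definition free_group (G : Type) : presentation :=
  @Presentation G (fun _ _ => False).

Section LocalSystems.
Variable F : fieldType.

Definition mxpowz d (A : 'M[F]_d) (z : int) : 'M[F]_d :=
  match z with
  | Posz m => A ^+ m
  | Negz m => invmx (A ^+ m.+1)
  end.

Fixpoint eval_word (G : Type) d (rho : G -> 'M[F]_d) (w : word G) : 'M[F]_d :=
  if w is p :: w' then mxpowz (rho p.1) p.2 *m eval_word rho w' else 1%:M.

Definition is_representation (X : presentation) d (rho : gen X -> 'M[F]_d) :=
  (forall g, rho g \in unitmx) /\
  (forall u v, rel u v -> eval_word rho u = eval_word rho v).

Lemma mx_expr_unit d (A : 'M[F]_d) m : A \in unitmx -> A ^+ m \in unitmx.
Proof.
move=> uA; elim: m => [|m IHm]; first by rewrite expr0 unitmx1.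
by rewrite exprS -[_ * _]/(A *m A ^+ m) unitmx_mul uA.
Qed.

Lemma mxpowz_unit d (A : 'M[F]_d) z : A \in unitmx -> mxpowz A z \in unitmx.
Proof. by move=> uA; case: z => m /=; rewrite ?unitmx_inv mx_expr_unit. Qed.

Lemma eval_word_unit (G : Type) d (rho : G -> 'M[F]_d) w :
  (forall g, rho g \in unitmx) -> eval_word rho w \in unitmx.
Proof.
move=> urho; elim: w => [|[g z] w IHw] /=; first exact: unitmx1.
by rewrite unitmx_mul mxpowz_unit.
Qed.

Lemma eval_word_cat (G : Type) d (rho : G -> 'M[F]_d) u v :
  eval_word rho (u ++ v) = eval_word rho u *m eval_word rho v.
Proof. by elim: u => [|p u IHu] /=; rewrite ?mul1mx // IHu mulmxA. Qed.

Lemma mxpowz1 d (A : 'M[F]_d) : mxpowz A 1 = A.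
Proof. exact: expr1. Qed.

Record local_system (X : presentation) := LocalSystem {
  rank : nat;
  mon : gen X -> 'M[F]_rank;
  monP : is_representation mon
}.

Definition conjugate d d' (A : 'M[F]_d) (B : 'M[F]_d') :=
  exists P : 'M[F]_(d, d'), [/\ row_free P, row_full P & A *m P = P *m B].

Definition isomorphic X (L M : local_system X) :=
  exists P : 'M[F]_(rank L, rank M),
    [/\ row_free P, row_full P & forall g, mon L g *m P = P *m mon M g].

Definition irreducible X (L : local_system X) :=
  (0 < rank L)%N /\
  forall U : 'M[F]_(rank L),
    (forall g, stablemx U (mon L g)^T) -> U = 0 \/ row_full U.

(* A continuous map X -> Y (here, inclusions of spaces) is given by the words
   representing the images of the generators. *)
Record pi1_map (X Y : presentation) := Pi1Map {
  img : gen X -> word (gen Y);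
  imgP : forall d (rho : gen Y -> 'M[F]_d), is_representation rho ->
    is_representation (X := X) (fun g => eval_word rho (img g))
}.

Definition restriction X Y (f : pi1_map X Y) (L : local_system Y) :=
  LocalSystem (imgP f (monP L)).

Lemma expr_dsum d e (A : 'M[F]_d) (B : 'M[F]_e) m :
  (block_mx A 0 0 B : 'M_(d + e)) ^+ m = block_mx (A ^+ m) 0 0 (B ^+ m).
Proof.
elim: m => [|m IHm]; first by rewrite !expr0 [LHS]scalar_mx_block.
by rewrite !exprS IHm [LHS]mulmx_block !mulmx0 !mul0mx !addr0 add0r.
Qed.

Lemma mxpowz_dsum d e (A : 'M[F]_d) (B : 'M[F]_e) z :
    A \in unitmx -> B \in unitmx ->
  mxpowz (block_mx A 0 0 B) z = block_mx (mxpowz A z) 0 0 (mxpowz B z).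
Proof.
move=> uA uB; case: z => m /=; first exact: expr_dsum.
by rewrite expr_dsum invmx_block_diag // block_diag_mx_unit !mx_expr_unit.
Qed.

Lemma dsum_representation X (L M : local_system X) :
  is_representation (fun g => block_mx (mon L g) 0 0 (mon M g)).
Proof.
have [[uL relL] [uM relM]] := (monP L, monP M).
have evalE w : eval_word (fun g => block_mx (mon L g) 0 0 (mon M g)) w =
    block_mx (eval_word (mon L) w) 0 0 (eval_word (mon M) w).
  elim: w => [|[g z] w IHw] /=; first exact: scalar_mx_block.
  by rewrite IHw mxpowz_dsum // mulmx_block !mulmx0 !mul0mx !addr0 add0r.
split=> [g|u v uv]; first by rewrite block_diag_mx_unit uL uM.
by rewrite !evalE (relL _ _ uv) (relM _ _ uv).
Qed.

Definition dsum X (L M : local_system X) := LocalSystem (dsum_representation L M).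

Lemma zero_representation X :
  is_representation (X := X) (fun _ => 1%:M : 'M[F]_0).
Proof. by split=> [g|u v _]; [exact: unitmx1 | apply/matrixP => -[]]. Qed.

Definition zero_system X := LocalSystem (@zero_representation X).

Definition dsum_pow X (L : local_system X) m := iter m (dsum L) (zero_system X).

(* ker (M - 1) on column vectors, i.e., V^gamma when M is the monodromy of gamma *)
Definition fixed_mx d (M : 'M[F]_d) : 'M[F]_d := kermx (M - 1%:M)^T.

Definition codim d m (U : 'M[F]_(m, d)) : nat := (d - \rank U)%N.

Definition pseudo_reflection d (M : 'M[F]_d) :=
  [/\ M \in unitmx, codim (fixed_mx M) = 1%N & \det M != 1].

Definition special_eigenvalue d (M : 'M[F]_d) : F := \det M.

Definition pochhammer_domain (I : finType) (L : local_system (free_group I)) :=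
  rank L = (\sum_(i : I) codim (fixed_mx (mon L i)))%N /\
  (\bigcap_(i : I) fixed_mx (mon L i) == (0 : 'M[F]_(rank L)))%MS.

Definition pochhammer1_domain (I : finType) (L : local_system (free_group I)) :=
  pochhammer_domain L /\ forall i, codim (fixed_mx (mon L i)) = 1%N.

(* 'I_l is 0-based: Alpha i stands for the meridian alpha_(i+1). *)
Inductive turbine_gen (l : nat) :=
  Alpha of 'I_l | Omega0 | OmegaInf | Delta.

Arguments Omega0 {l}.
Arguments OmegaInf {l}.
Arguments Delta {l}.

Definition alpha_prod (G : Type) l (a : 'I_l -> G) : word G :=
  [seq (a i, 1 : int) | i <- enum 'I_l].

Inductive shaft_rel (l : nat) :
    word (turbine_gen l) -> word (turbine_gen l) -> Prop :=
| shaft_rel_prod :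
    shaft_rel (alpha_prod (@Alpha l) ++ [:: (OmegaInf, 1)]) [:: (Omega0, 1)]
| shaft_rel_central g :
    shaft_rel [:: (Delta, 1); (g, 1)] [:: (g, 1); (Delta, 1)].

Inductive bare_rel (k : nat) (r : int) (l : nat) :
    word (turbine_gen l) -> word (turbine_gen l) -> Prop :=
| bare_rel_shaft u v : shaft_rel u v -> bare_rel k r u v
| bare_rel_pow : bare_rel k r [:: (Omega0, k%:Z)] [:: (Delta, r)].

(* pi_1 of the turbine with shaft T*_{n,k,l} *)
Definition turbine_shaft (l : nat) : presentation :=
  Presentation (@shaft_rel l).

(* pi_1 of the turbine without shaft T_{n,k,l}; n and s only enter through
   r n = k s + 1 *)
Definition turbine (k : nat) (r : int) (l : nat) : presentation :=
  Presentation (@bare_rel k r l).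

(* D'_bullet and T*_{n,k,bullet}, T_{n,k,bullet}; in the last two the
   generator Alpha ord0 is alpha_bullet *)
Definition disc_section (l : nat) : presentation := free_group 'I_l.

Notation turbine_shaft_bullet := (turbine_shaft 1).

Lemma shaft_of_bare k r l d (rho : turbine_gen l -> 'M[F]_d) :
  is_representation (X := turbine k r l) rho ->
  is_representation (X := turbine_shaft l) rho.
Proof. by case=> urho rrho; split=> // u v uv; apply/rrho/bare_rel_shaft. Qed.

Lemma free_map_subproof (G : Type) Y (f : G -> word (gen Y)) d
    (rho : gen Y -> 'M[F]_d) : is_representation rho ->
  is_representation (X := free_group G) (fun g => eval_word rho (f g)).
Proof. by case=> urho _; split=> // g; apply: eval_word_unit. Qed.

Definition free_map (G : Type) Y (f : G -> word (gen Y)) :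
  pi1_map (free_group G) Y := Pi1Map (@free_map_subproof G Y f).

Lemma rho_central l d (rho : turbine_gen l -> 'M[F]_d) g :
  is_representation (X := turbine_shaft l) rho ->
  rho Delta *m rho g = rho g *m rho Delta.
Proof.
by case=> _ /(_ _ _ (shaft_rel_central g)) /=; rewrite !expr1 !mulmx1.
Qed.

Inductive torus_gen := Transverse | Fibre.

Inductive torus_rel : word torus_gen -> word torus_gen -> Prop :=
| torus_rel_comm : torus_rel [:: (Transverse, 1); (Fibre, 1)]
                             [:: (Fibre, 1); (Transverse, 1)].

Definition torus : presentation := Presentation torus_rel.

(* The boundary components dN_0, dN_infty, dN_i *)
Inductive component (l : nat) := Inner | Outer | Blade of 'I_l.

Definition boundary_word l (c : component l) (t : torus_gen) :
    word (turbine_gen l) :=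
  match t with
  | Fibre => [:: (Delta, 1)]
  | Transverse => match c with
                  | Inner => [:: (Omega0, 1)]
                  | Outer => [:: (OmegaInf, 1)]
                  | Blade i => [:: (Alpha i, 1)]
                  end
  end.

Lemma boundary_shaft_subproof l (c : component l) d
    (rho : gen (turbine_shaft l) -> 'M[F]_d) : is_representation rho ->
  is_representation (X := torus) (fun t => eval_word rho (boundary_word c t)).
Proof.
move=> rrho; split=> [g|_ _ []].
  by case: rrho => urho _; apply: eval_word_unit.
have comm := fun g => rho_central g rrho.
by case: c => [||i] /=; rewrite !expr1 !mulmx1 comm.
Qed.

Definition boundary_shaft l (c : component l) : pi1_map torus (turbine_shaft l) :=
  Pi1Map (@boundary_shaft_subproof l c).

Lemma boundary_bare_subproof k r l (c : component l) d
    (rho : gen (turbine k r l) -> 'M[F]_d) : is_representation rho ->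
  is_representation (X := torus) (fun t => eval_word rho (boundary_word c t)).
Proof. by move/shaft_of_bare; exact: boundary_shaft_subproof. Qed.

Definition boundary_bare k r l (c : component l) :
  pi1_map torus (turbine k r l) := Pi1Map (@boundary_bare_subproof k r l c).

Definition rigid_shaft l (L : local_system (turbine_shaft l)) :=
  forall M : local_system (turbine_shaft l),
    (forall c : component l, isomorphic (restriction (boundary_shaft c) M)
                                        (restriction (boundary_shaft c) L)) ->
    isomorphic M L.

(* without shaft, dN_0 is not a boundary component *)
Definition rigid_bare k r l (L : local_system (turbine k r l)) :=
  forall M : local_system (turbine k r l),
    (forall c : component l, c <> Inner l ->
       isomorphic (restriction (boundary_bare k r c) M)
                  (restriction (boundary_bare k r c) L)) ->
    isomorphic M L.

(* The circles dD_i (Some i) and dD_bullet (None), each with pi_1 = Z *)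
Definition circle_map l (c : option 'I_l) :
    pi1_map (free_group unit) (disc_section l) :=
  @free_map unit (disc_section l)
    (fun _ => if c is Some i then [:: (i, 1)] else alpha_prod id).

Definition rigid_disc l (L : local_system (disc_section l)) :=
  forall M : local_system (disc_section l),
    (forall c : option 'I_l, isomorphic (restriction (circle_map c) M)
                                        (restriction (circle_map c) L)) ->
    isomorphic M L.

(* The loop omega_0^(k-1-j) alpha_i omega_0^(1-k+j), for (i, j) = ij *)
Definition blade_loop k l (ij : 'I_l * 'I_k) : word (turbine_gen l) :=
  [:: (Omega0, k%:Z - 1 - (ij.2 : nat)%:Z); (Alpha ij.1, 1);
      (Omega0, 1 - k%:Z + (ij.2 : nat)%:Z)].

(* alpha_0 = delta^r omega_0^(-k) *)
Definition alpha0_loop k (r : int) l : word (turbine_gen l) :=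
  [:: (Delta, r); (Omega0, - k%:Z)].

(* The sections of the turbines by a generic line x = const; None is alpha_0. *)
Definition line_shaft k r l :
    pi1_map (free_group (option ('I_l * 'I_k))) (turbine_shaft l) :=
  @free_map _ (turbine_shaft l)
    (fun c => if c is Some ij then blade_loop ij else alpha0_loop k r l).

Definition line_bare k r l :
    pi1_map (free_group ('I_l * 'I_k)) (turbine k r l) :=
  @free_map _ (turbine k r l) (@blade_loop k l).

Definition pochhammer_shaft k r l (L : local_system (turbine_shaft l)) :=
  pochhammer_domain (restriction (line_shaft k r l) L).
Definition pochhammer1_shaft k r l (L : local_system (turbine_shaft l)) :=
  pochhammer1_domain (restriction (line_shaft k r l) L).
Definition pochhammer1_bare k r l (L : local_system (turbine k r l)) :=
  pochhammer1_domain (restriction (line_bare k r l) L).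

Definition diag_of (s : seq F) : 'M[F]_(size s) :=
  diag_mx (\row_(i < size s) s`_i).

(* The spectrum  x_1 (m_1 times), ..., x_p (m_p times) *)
Definition with_mult p (x : 'I_p -> F) (m : 'I_p -> nat) : seq F :=
  flatten [seq nseq (m i) (x i) | i <- enum 'I_p].

(* zeta enumerates the k-th roots of a, for a <> 0 *)
Definition enum_roots k (a : F) (zeta : 'I_k -> F) :=
  injective zeta /\ forall i, zeta i ^+ k = a.

Definition data_shaft k (r : int) l p (L : local_system (turbine_shaft l))
    (eps b : F) (lam : 'I_l -> F) (xi : 'I_p -> F) (m : 'I_p -> nat) :=
  [/\ mon L Delta = eps%:M,
      forall i, pseudo_reflection (mon L (Alpha i)) /\
                special_eigenvalue (mon L (Alpha i)) = lam i,
      exists2 zeta : 'I_k -> F, enum_roots (eps ^ r) zeta &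
        conjugate (mon L Omega0) (diag_of (rcons (with_mult zeta (fun=> l)) b)),
      injective xi &
      conjugate (mon L OmegaInf) (diag_of (with_mult xi m))].

Definition data_bare k (r : int) l p (L : local_system (turbine k r l))
    (eps : F) (lam : 'I_l -> F) (xi : 'I_p -> F) (m : 'I_p -> nat) :=
  [/\ mon L Delta = eps%:M,
      forall i, pseudo_reflection (mon L (Alpha i)) /\
                special_eigenvalue (mon L (Alpha i)) = lam i,
      exists2 zeta : 'I_k -> F, enum_roots (eps ^ r) zeta &
        conjugate (mon L Omega0) (diag_of (with_mult zeta (fun=> l))),
      injective xi &
      conjugate (mon L OmegaInf) (diag_of (with_mult xi m))].

Definition data_disc l (L : local_system (disc_section l))
    (lam : 'I_l -> F) (eta1 eta2 : F) :=
  [/\ rank L = l,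
      forall i : 'I_l, pseudo_reflection (mon L i) /\
                       special_eigenvalue (mon L i) = lam i &
      conjugate (eval_word (mon L) (alpha_prod id))
                (diag_of (rcons (nseq l.-1 eta1) eta2))].

Definition determined_by X (L : local_system X) (D : local_system X -> Prop) :=
  D L /\ forall M, D M -> isomorphic M L.

Definition semisimple_at_infinity l (L : local_system (turbine_shaft l)) :=
  diagonalizable (mon L OmegaInf).

(* T*_{n,k,bullet} in T*_{n,k,l}: alpha_bullet = alpha_1 ... alpha_l *)
Definition bullet_word l (g : turbine_gen 1) : word (turbine_gen l) :=
  match g with
  | Alpha _ => alpha_prod (@Alpha l)
  | Omega0 => [:: (Omega0, 1)]
  | OmegaInf => [:: (OmegaInf, 1)]
  | Delta => [:: (Delta, 1)]
  end.

Lemma bullet_subproof l d (rho : gen (turbine_shaft l) -> 'M[F]_d) :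
  is_representation rho ->
  is_representation (X := turbine_shaft_bullet)
    (fun g => eval_word rho (bullet_word l g)).
Proof.
move=> rrho; have [urho relrho] := rrho.
split=> [g|u v]; first exact: eval_word_unit.
case=> [|g].
  have := relrho _ _ (shaft_rel_prod l).
  by rewrite eval_word_cat /alpha_prod enum_ordSl enum_ord0 /= !expr1 !mulmx1.
have comm : rho Delta *m eval_word rho (alpha_prod (@Alpha l)) =
            eval_word rho (alpha_prod (@Alpha l)) *m rho Delta.
  rewrite /alpha_prod; elim: (enum _) => [|i e IHe] /=.
    by rewrite mulmx1 mul1mx.
  by rewrite expr1 mulmxA rho_central // -!mulmxA IHe.
case: g => [i|||] /=; rewrite !expr1 !mulmx1 ?rho_central //; exact: comm.
Qed.

Definition bullet_map l : pi1_map turbine_shaft_bullet (turbine_shaft l) :=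
  Pi1Map (@bullet_subproof l).

(* T*_{n,k,l} in T_{n,k,l} *)
Lemma forget_subproof k r l d (rho : gen (turbine k r l) -> 'M[F]_d) :
  is_representation rho ->
  is_representation (X := turbine_shaft l)
    (fun g => eval_word rho [:: (g, 1 : int)]).
Proof.
move=> /shaft_of_bare[urho relrho]; split=> [g|u v uv].
  exact: eval_word_unit.
have E w : eval_word (fun g => eval_word rho [:: (g, 1 : int)]) w = eval_word rho w.
  by elim: w => [|[g z] w IHw] //=; rewrite IHw expr1 mulmx1.
by rewrite !E; apply: relrho.
Qed.

Definition forget_map k r l : pi1_map (turbine_shaft l) (turbine k r l) :=
  Pi1Map (@forget_subproof k r l).

(* D'_bullet in T*_{n,k,l} *)
Definition disc_map l : pi1_map (disc_section l) (turbine_shaft l) :=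
  @free_map _ (turbine_shaft l) (fun i => [:: (Alpha i, 1)]).

(* A subsheaf of a local system is constant iff monodromy acts trivially on it. *)
Definition constant_subsystem X (L : local_system X) (K : 'M[F]_(rank L)) :=
  forall g, (K <= fixed_mx (mon L g))%MS.

(* L / K is isomorphic to M: there is a surjective morphism v |-> Q v from L
   to M with kernel K. *)
Definition quotient_iso X (L : local_system X) (K : 'M[F]_(rank L))
    (M : local_system X) :=
  exists Q : 'M[F]_(rank M, rank L),
    [/\ forall g, Q *m mon L g = mon M g *m Q,
        row_free Q & (kermx Q^T :=: K)%MS].

Definition is_extension k r l (L : local_system (turbine_shaft l))
    (L' : local_system turbine_shaft_bullet)
    (Lt : local_system (disc_section l)) :=
  [/\ pochhammer_shaft k r L, pochhammer_shaft k r L', pochhammer_domain Lt,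
      isomorphic (restriction (bullet_map l) L) L' &
      exists2 K : 'M[F]_(rank (restriction (disc_map l) L)),
        constant_subsystem K & quotient_iso K Lt].

End LocalSystems.

Notation turbine_shaft_bullet := (turbine_shaft 1).
Notation turbine_bullet k r := (turbine k r 1).

(* Main.v *)
Require Import Defs.
From mathcomp Require Import all_boot all_order perm all_algebra separable.
From mathcomp Require Import reals complex ring zify.

(* Matrices act on the right on row vectors.  Write [L'] for [F^(l-1) (+) G] and put
   [alpha = Omega0 OmegaInf^-1].

   Omega0 and OmegaInf are annihilated by coprime polynomials, so they agree on no nonzero submodule
   and on no nonzero quotient, i.e. every submodule on which [alpha] is trivial vanishes, and so does
   every such quotient.  The irreducibility of F, G and of the extension, and the vanishing of the
   intersection of fixed spaces in the Pochhammer condition, reduce to this.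

   F and G are companion-matrix (hypergeometric) systems.  A vector on which the powers of Omega0
   and OmegaInf agree up to the right order generates a copy of F or G; counting the linear conditions
   on such vectors shows that every semi-simple pair (Omega0, OmegaInf) with the spectra prescribed
   in (iv) and [rank (alpha - 1) <= l] is a sum of [l - 1] copies of F and one copy of G.

   On the disc, write the reflections in the basis dual to their linear forms as
   [alpha_i = 1 + u_i e_i]; if [N] is the strictly upper triangular part of the matrix [U] of the
   [u_i], then [(prod alpha_i) (1 - N) = 1 + U - N], so that asking for [prod alpha_i - eta1] to have
   rank one determines [U] up to a diagonal change of basis.

   Finally 1 is not an eigenvalue of [alpha] on the image of [alpha - 1], which is therefore a
   complement of [ker (alpha - 1)]; an extension is obtained by letting the [alpha_i] act trivially on
   this kernel and as the disc system on the image.  The identification of the image with the disc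
   system is unique up to the centralizer [GL_1 x GL_(l-1)] of [prod alpha_i], and this group lifts to
   automorphisms of [L'], whence the uniqueness of the extension. *)

Set Implicit Arguments.
Unset Strict Implicit.
Unset Printing Implicit Defensive.

Import Order.TTheory GRing.Theory Num.Theory.
Local Open Scope ring_scope.

(** * Linear algebra *)

Section LinearAlgebra.
Variable C : fieldType.

Lemma invertible_ex d d' (P : 'M[C]_(d, d')) : row_free P -> row_full P ->
  exists P' : 'M[C]_(d', d), P *m P' = 1%:M /\ P' *m P = 1%:M.
Proof.
move=> /row_freeP[A PA] /row_fullP[B BP]; exists A; split=> //.
suff -> : A = B by [].
by rewrite -[LHS]mul1mx -BP -mulmxA PA mulmx1.
Qed.

Lemma invertible_free d d' (P : 'M[C]_(d, d')) (P' : 'M[C]_(d', d)) :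
  P *m P' = 1%:M -> P' *m P = 1%:M -> row_free P /\ row_full P.
Proof. by move=> a b; split; [apply/row_freeP; exists P' | apply/row_fullP; exists P']. Qed.

Lemma row_free_full_eq d d' (P : 'M[C]_(d, d')) : row_free P -> row_full P -> d = d'.
Proof. by move=> /eqP a /eqP b; exact: etrans (esym a) b. Qed.

Lemma square_full_free d d' (P : 'M[C]_(d, d')) : d = d' -> row_full P -> row_free P.
Proof. by move=> e /eqP u; apply/eqP; rewrite u e. Qed.

Lemma mxrank_intertwined d d' (A : 'M[C]_d) (B : 'M[C]_d') (P : 'M[C]_(d, d')) :
  row_free P -> row_full P -> A *m P = P *m B -> \rank A = \rank B.
Proof.
move=> fP uP APB; by rewrite -(mxrankMfree A fP) APB (eqmxMfull _ uP).
Qed.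

Lemma det_intertwined d d' (A : 'M[C]_d) (B : 'M[C]_d') (P : 'M[C]_(d, d')) :
  row_free P -> row_full P -> A *m P = P *m B -> \det A = \det B.
Proof.
move=> fP uP; move: (row_free_full_eq fP uP) => e.
case: _ / e in B P fP uP * => APB.
have uP' : P \in unitmx by rewrite -row_free_unit.
have nzP : \det P != 0 by rewrite -unitfE -unitmxE.
by apply: (mulIf nzP); rewrite -det_mulmx APB det_mulmx mulrC.
Qed.

Lemma scalar_intertwined d d' (B : 'M[C]_d') (P : 'M[C]_(d, d')) (a : C) :
  row_full P -> a%:M *m P = P *m B -> B = a%:M.
Proof.
move=> /row_fullP[Q QP] aPB.
by rewrite -[B]mul1mx -QP -mulmxA -aPB mul_scalar_mx -scalemxAr QP scalemx1.
Qed.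

Lemma conjugate_sym d d' (A : 'M[C]_d) (B : 'M[C]_d') : conjugate A B -> conjugate B A.
Proof.
case=> P [fP uP APB]; have [P' [PP' P'P]] := invertible_ex fP uP.
have [fP' uP'] := invertible_free P'P PP'.
exists P'; split=> //.
by rewrite -[B]mul1mx -P'P -(mulmxA P') -APB -!mulmxA PP' mulmx1.
Qed.

Lemma conjugate_trans d d' d'' (A : 'M[C]_d) (B : 'M[C]_d') (E : 'M[C]_d'') :
  conjugate A B -> conjugate B E -> conjugate A E.
Proof.
case=> P [fP uP APB] [Q [fQ uQ BQE]]; exists (P *m Q); split.
- by rewrite /row_free mxrankMfree.
- by rewrite /row_full (eqmxMfull Q uP).
- by rewrite mulmxA APB -!mulmxA BQE.
Qed.

Lemma conjugate_refl d (A : 'M[C]_d) : conjugate A A.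
Proof. by exists 1%:M; rewrite row_free_unit row_full_unit unitmx1 mulmx1 mul1mx. Qed.

Lemma isomorphic_sym X (L M : local_system C X) : isomorphic L M -> isomorphic M L.
Proof.
case=> P [fP uP APB]; have [P' [PP' P'P]] := invertible_ex fP uP.
have [fP' uP'] := invertible_free P'P PP'.
exists P'; split=> // g.
by rewrite -[mon M g]mul1mx -P'P -(mulmxA P') -APB -!mulmxA PP' mulmx1.
Qed.

(** * Polynomials in a square matrix *)

Lemma expmxS d (A : 'M[C]_d) i : A ^+ i.+1 = A *m A ^+ i.
Proof. exact: exprS. Qed.

Lemma expmxSr d (A : 'M[C]_d) i : A ^+ i.+1 = A ^+ i *m A.
Proof. exact: exprSr. Qed.

Lemma expmx_intertwined d d' (A : 'M[C]_d) (B : 'M[C]_d') (P : 'M[C]_(d, d')) i :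
  A *m P = P *m B -> A ^+ i *m P = P *m B ^+ i.
Proof.
move=> APB; elim: i => [|i IHi]; first by rewrite !expr0 mul1mx mulmx1.
by rewrite !expmxSr -mulmxA APB mulmxA IHi -mulmxA.
Qed.

(* [horner_mx] is only available for matrices of positive size. *)
Definition evm d (A : 'M[C]_d) (p : {poly C}) : 'M[C]_d :=
  \sum_(i < size p) p`_i *: A ^+ i.

Lemma evm_intertwined d d' (A : 'M[C]_d) (B : 'M[C]_d') (P : 'M[C]_(d, d')) p :
  A *m P = P *m B -> evm A p *m P = P *m evm B p.
Proof.
move=> APB; rewrite /evm mulmx_suml mulmx_sumr; apply: eq_bigr => i _.
by rewrite -scalemxAl -scalemxAr (expmx_intertwined i APB).
Qed.

Lemma evm_horner d (A : 'M[C]_d.+1) p : evm A p = horner_mx A p.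
Proof.
rewrite -[in RHS](coefK p) poly_def rmorph_sum; apply: eq_bigr => i _.
by rewrite /= horner_mxZ rmorphXn /= horner_mx_X.
Qed.

Lemma evm_tr d (A : 'M[C]_d) p : evm A^T p = (evm A p)^T.
Proof.
rewrite /evm raddf_sum; apply: eq_bigr => i _; rewrite /= [RHS]linearZ /=; congr (_ *: _).
elim: (i : nat) => [|j IHj]; first by rewrite !expr0 [RHS]trmx1.
by rewrite expmxS IHj expmxSr [RHS]trmx_mul.
Qed.

(** Evaluating a Bezout relation [u p + v q = 1] at [A] leaves [v(A) q(A) = 1]. In size 0 the empty
    determinant is 1. *)
Lemma evm_coprime_unit d (A : 'M[C]_d) p q :
  coprimep p q -> evm A p = 0 -> evm A q \in unitmx.
Proof.
case: d A => [|d] A; first by rewrite unitmxE det_mx00 unitr1.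
rewrite !evm_horner => /Bezout_eq1_coprimepP[[u v] /= uv1] Ap0.
have /(congr1 (horner_mx A)) := uv1.
rewrite rmorphD !rmorphM /= Ap0 mulr0 add0r rmorph1 => vq.
by apply: (proj2 (mulmx1_unit vq)).
Qed.

Lemma evm_XnsubC d (A : 'M[C]_d) k a : (0 < k)%N ->
  evm A ('X^k - a%:P) = A ^+ k - a%:M.
Proof.
case: d A => [|d] A k0; first by rewrite [LHS]flatmx0 [RHS]flatmx0.
by rewrite evm_horner rmorphB /= rmorphXn /= horner_mx_X horner_mx_C.
Qed.

Lemma evm_monic_split d (A : 'M[C]_d) p : p \is monic ->
  evm A p = \sum_(i < (size p).-1) p`_i *: A ^+ i + A ^+ (size p).-1.
Proof.
move=> mp; have : (0 < size p)%N by rewrite size_poly_gt0 monic_neq0.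
rewrite /evm; case E: (size p) => [//|n] _; rewrite big_ord_recr /=.
by move/monicP: mp; rewrite /lead_coef E /= => ->; rewrite scale1r.
Qed.

Lemma evm_eq_on m d (U : 'M[C]_(m, d)) (A B : 'M[C]_d) p :
  stablemx U A -> U *m A = U *m B -> U *m evm A p = U *m evm B p.
Proof.
move=> stU UAB; rewrite /evm !mulmx_sumr; apply: eq_bigr => i _.
rewrite -!scalemxAr; congr (_ *: _).
elim: (i : nat) => [|j IHj]; first by rewrite !expr0.
have /submxP[X UA] := stU.
rewrite !expmxS !mulmxA UA -(mulmxA X).
by rewrite IHj mulmxA -UA UAB.
Qed.

(** * Spectra given as lists of eigenvalues *)

Lemma mxrank_diag_row s (f : C -> C) :
  \rank (diag_mx (\row_(i < size s) f s`_i)) = count (fun x => f x != 0) s.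
Proof.
elim: s => [|x s IHs] /=; first by rewrite thinmx0 mxrank0.
transitivity (\rank (diag_mx (row_mx (\row_(i < 1) f x) (\row_(i < size s) f s`_i)))).
  congr (\rank (diag_mx _)); apply/rowP => i; rewrite !mxE.
  by case: splitP => j ->; rewrite !mxE ?add1n // ord1.
rewrite diag_mx_row rank_diag_block_mx IHs; congr (_ + _)%N.
rewrite [diag_mx _]mx11_scalar !mxE eqxx mulr1n.
case: eqVneq => [-> | fx]; first by rewrite raddf0 mxrank0.
by rewrite -scalemx1 mxrank_scale_nz ?mxrank1.
Qed.

Lemma evm_diag_of s p :
  evm (diag_of s) p = diag_mx (\row_(i < size s) p.[s`_i]) :> 'M[C]_(size s).
Proof.
case: s => [|x s]; first by rewrite [LHS]flatmx0 [RHS]flatmx0.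
rewrite evm_horner horner_mx_diag; congr diag_mx.
by apply/rowP => i; rewrite !mxE.
Qed.

(** Annihilating polynomials and rank conditions on polynomials in [A] are read off the prescribed
    spectrum through this count: conjugation carries [p(A)] to the diagonal matrix of the values of
    [p]. *)
Lemma conjugate_rank_evm d (A : 'M[C]_d) s p : conjugate A (diag_of s) ->
  \rank (evm A p) = count (fun x => p.[x] != 0) s.
Proof.
case=> P [fP uP APD]; rewrite (mxrank_intertwined fP uP (evm_intertwined p APD)).
by rewrite evm_diag_of (mxrank_diag_row _ (horner p)).
Qed.

Lemma conjugate_size d (A : 'M[C]_d) s : conjugate A (diag_of s) -> d = size s.
Proof. by case=> P [fP uP _]; exact: row_free_full_eq fP uP. Qed.

Lemma conjugate_evm0 d (A : 'M[C]_d) s p : conjugate A (diag_of s) ->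
  all (root p) s -> evm A p = 0.
Proof.
move=> cA rs; apply/eqP; rewrite -mxrank_eq0 (conjugate_rank_evm _ cA) eqn0Ngt.
rewrite -has_count -all_predC.
by apply: sub_all rs => x; rewrite /= negbK.
Qed.

Lemma det_diag_of s : \det (diag_of s : 'M[C]_(size s)) = \prod_(x <- s) x.
Proof.
rewrite det_diag (big_nth 0) big_mkord; apply: eq_bigr => i _.
by rewrite mxE.
Qed.

Lemma conjugate_det d (A : 'M[C]_d) s : conjugate A (diag_of s) ->
  \det A = \prod_(x <- s) x.
Proof. by case=> P [fP uP /(det_intertwined fP uP)->]; exact: det_diag_of. Qed.

(** Only the multiset of eigenvalues matters, so the spectrum of a direct sum can be compared with a
    prescribed one by counting. *)
Lemma conjugate_diag_perm n (v : 'rV[C]_n) s :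
  perm_eq s [seq v 0 i | i <- enum 'I_n] -> conjugate (diag_mx v) (diag_of s).
Proof.
move=> sv; have e : size s = n by rewrite (perm_size sv) size_map size_enum_ord.
case: n / e v sv => v sv.
have /tuple_permP[p sE] : perm_eq s [tuple v 0 i | i < size s] by [].
have sP (j : 'I_(size s)) : s`_j = v 0 (p j).
  by rewrite (congr1 (nth 0 ^~ j) sE) -tnth_nth !tnth_mktuple.
have fP : row_free (perm_mx p^-1%g : 'M[C]_(size s)) by rewrite row_free_unit unitmx_perm.
have uP : row_full (perm_mx p^-1%g : 'M[C]_(size s)) by rewrite row_full_unit unitmx_perm.
exists (perm_mx p^-1%g); split=> //.
rewrite mul_diag_mx mul_mx_diag; apply/matrixP => i j; rewrite !mxE sP.
case: eqP => [<-|_]; last by rewrite mulr0 mul0r.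
by rewrite permKV mulr1 mul1r.
Qed.

Lemma conjugate_block d e d' e' (A : 'M[C]_d) (B : 'M[C]_e) (A' : 'M[C]_d') (B' : 'M[C]_e') :
  conjugate A A' -> conjugate B B' ->
  conjugate (block_mx A 0 0 B : 'M_(d + e)) (block_mx A' 0 0 B' : 'M_(d' + e')).
Proof.
case=> P [fP uP APB] [Q [fQ uQ BQE]].
have [P' [PP' P'P]] := invertible_ex fP uP; have [Q' [QQ' Q'Q]] := invertible_ex fQ uQ.
have [||f u] := @invertible_free (d + e) (d' + e') (block_mx P 0 0 Q) (block_mx P' 0 0 Q').
- by rewrite mulmx_block !mulmx0 !mul0mx !addr0 add0r PP' QQ' -scalar_mx_block.
- by rewrite mulmx_block !mulmx0 !mul0mx !addr0 add0r P'P Q'Q -scalar_mx_block.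
exists (block_mx P 0 0 Q); split=> //.
by rewrite !mulmx_block !mulmx0 !mul0mx !addr0 !add0r APB BQE.
Qed.

Lemma conjugate_diag_cat d e (A : 'M[C]_d) (B : 'M[C]_e) s t u :
  conjugate A (diag_of s) -> conjugate B (diag_of t) -> perm_eq u (s ++ t) ->
  conjugate (block_mx A 0 0 B : 'M_(d + e)) (diag_of u).
Proof.
move=> cA cB eu; apply: conjugate_trans (conjugate_block cA cB) _.
rewrite -diag_mx_row; apply: conjugate_diag_perm; apply: (perm_trans eu).
suff -> : s ++ t = [seq row_mx (\row_(i < size s) s`_i) (\row_(i < size t) t`_i) 0 i
                    | i <- enum 'I_(size s + size t)] by [].
rewrite -[LHS](mkseq_nth 0) /mkseq size_cat -val_enum_ord -map_comp.
apply: eq_map => i; rewrite /= mxE nth_cat.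
case: splitP => j ->; rewrite mxE ?ltn_ord //.
by rewrite addKn.
Qed.

End LinearAlgebra.

(** * Rank-one perturbations and irreducibility *)

Section Reflections.
Variable C : fieldType.

Lemma rank_le1 m n (A : 'M[C]_(m, n)) : (\rank A <= 1)%N ->
  exists (x : 'cV_m) (y : 'rV_n), A = x *m y.
Proof.
move=> rA; have := mulmx_base A; move: (col_base A) (row_base A).
case: (\rank A) rA => [|[|//]] _ x y <-; last by exists x, y.
by exists 0, 0; rewrite [y]flatmx0 !mulmx0.
Qed.

Lemma mxrank_outer m n (x : 'cV[C]_m) (y : 'rV[C]_n) : (\rank (x *m y) <= 1)%N.
Proof. exact: mulmx_max_rank. Qed.

(** Sylvester's identity: both sides are the determinant of the block matrix with rows [1, -X] and
    [Y, 1], made triangular by eliminating either off-diagonal block. *)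
Lemma det_1D_mulC m n (X : 'M[C]_(m, n)) (Y : 'M[C]_(n, m)) :
  \det (1%:M + X *m Y) = \det (1%:M + Y *m X).
Proof.
have E1 : block_mx 1%:M (- X) Y 1%:M = 
  (block_mx 1%:M 0 Y 1%:M : 'M_(m + n)) *m block_mx 1%:M (- X) 0 (1%:M + Y *m X).
  by rewrite mulmx_block !mulmx0 !mul0mx !mul1mx !mulmx1 !addr0 mulmxN addrCA addNr addr0.
have E2 : block_mx 1%:M (- X) Y 1%:M = 
  (block_mx 1%:M (- X) 0 1%:M : 'M_(m + n)) *m block_mx (1%:M + X *m Y) 0 Y 1%:M.
  by rewrite mulmx_block !mulmx0 !mul0mx !mul1mx !mulmx1 !add0r mulNmx addrK.
have := congr1 determinant (etrans (esym E1) E2).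
by rewrite !det_mulmx !det_lblock !det_ublock !det1 !mul1r mulr1.
Qed.

Lemma det_1D_outer m (x : 'cV[C]_m) (y : 'rV[C]_m) :
  \det (1%:M + x *m y) = 1 + (y *m x) 0 0.
Proof. by rewrite det_1D_mulC [X in \det X]mx11_scalar det_scalar1 !mxE. Qed.

Lemma det_scalar_outer m (a : C) (x : 'cV[C]_m.+1) (y : 'rV[C]_m.+1) : a != 0 ->
  \det (a%:M + x *m y) = a ^+ m * (a + (y *m x) 0 0).
Proof.
move=> a0; have -> : a%:M + x *m y = a *: (1%:M + (a^-1 *: x) *m y).
  by rewrite scalerDr scalemx1 -scalemxAl scalerA divff // scale1r.
rewrite detZ det_1D_outer exprSr -mulrA mulrDr mulr1 -scalemxAr mxE.
by rewrite mulrA divff // mul1r.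
Qed.

(** The matrices act on row vectors here, whereas [irreducible] lets them act on columns;
    [row_irreducible_tr] passes from one to the other by annihilators. *)
Definition row_irreducible (I : Type) d (A : I -> 'M[C]_d) :=
  forall m (U : 'M[C]_(m, d)), (forall i, stablemx U (A i)) -> U = 0 \/ row_full U.

Lemma row_irreducible_tr (I : Type) d (A : I -> 'M[C]_d) (U : 'M[C]_d) :
  row_irreducible A -> (forall i, stablemx U (A i)^T) -> U = 0 \/ row_full U.
Proof.
move=> irrA stU; have stW i : stablemx (kermx U^T) (A i).
  apply/sub_kermxP; rewrite -mulmxA -[A i]trmxK -trmx_mul.
  by have /submxP[X ->] := stU i; rewrite trmx_mul mulmxA mulmx_ker mul0mx.
case: (irrA _ _ stW) => [K0 | Kf]; last first.
  left; apply: trmx_inj; rewrite trmx0; have := mulmx_ker U^T.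
  rewrite row_full_unit in Kf => KU.
  by rewrite -[LHS](mulKmx Kf) KU mulmx0.
right; have : row_free U^T by rewrite -kermx_eq0 K0.
by rewrite /row_free mxrank_tr.
Qed.

Lemma row_irreducible_conj (I : Type) d (A B : I -> 'M[C]_d) (Z : 'M[C]_d) :
  Z \in unitmx -> (forall i, A i *m Z = Z *m B i) -> row_irreducible A -> row_irreducible B.
Proof.
move=> uZ AZB irrA m U stU.
have [|UZ0|UZf] := irrA m (U *m invmx Z).
- move=> i; have /submxP[X UX] := stU i; apply/submxP; exists X.
  have ZAB : invmx Z *m A i = B i *m invmx Z.
    by rewrite -[LHS](mulmxK uZ) -(mulmxA _ (A i)) AZB (mulKmx uZ).
  by rewrite mulmxA -UX -!mulmxA ZAB.
- by left; rewrite -[U](mulmxKV uZ) UZ0 mul0mx.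
- right; move: UZf; rewrite /row_full mxrankMfree //.
  by rewrite row_free_unit unitmx_inv.
Qed.

(** On [U] the polynomial [q] takes the same value at [A] as at [B], namely zero, while [q(A)] is
    invertible. *)
Lemma no_common_sub m d (A B : 'M[C]_d) (U : 'M[C]_(m, d)) p q :
  coprimep p q -> evm A p = 0 -> evm B q = 0 ->
  stablemx U A -> U *m A = U *m B -> U = 0.
Proof.
move=> pq Ap Bq stU UAB.
have := evm_eq_on q stU UAB; rewrite Bq mulmx0 => UAq.
by rewrite -[U](mulmxK (evm_coprime_unit pq Ap)) UAq mul0mx.
Qed.

(** The annihilator of [U] is stable under [A^T], which agrees with [B^T] there, so [no_common_sub]
    kills it. *)
Lemma no_common_quotient m d (A B : 'M[C]_d) (U : 'M[C]_(m, d)) p q :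
  coprimep p q -> evm A p = 0 -> evm B q = 0 ->
  stablemx U A -> (A - B <= U)%MS -> row_full U.
Proof.
move=> pq Ap Bq stU AB.
have stW : stablemx (kermx U^T) A^T.
  apply/sub_kermxP; rewrite -mulmxA -trmx_mul.
  by have /submxP[X ->] := stU; rewrite trmx_mul mulmxA mulmx_ker mul0mx.
have : kermx U^T = 0.
  apply: (@no_common_sub _ _ A^T B^T _ p q) => //.
  - by rewrite evm_tr Ap trmx0.
  - by rewrite evm_tr Bq trmx0.
  apply/eqP; rewrite -subr_eq0 -mulmxBr -raddfB /=.
  by have /submxP[X ->] := AB; rewrite trmx_mul mulmxA mulmx_ker mul0mx.
by move/eqP; rewrite kermx_eq0 /row_free mxrank_tr.
Qed.

Lemma prod_sub1_rows (I : Type) (r : seq I) m d (A : I -> 'M[C]_d) (F : 'M[C]_(m, d)) :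
  (forall i, (A i - 1%:M <= F)%MS) -> (\prod_(i <- r) A i - 1%:M <= F)%MS.
Proof.
move=> AF; apply: (big_ind (fun T : 'M_d => (T - 1%:M <= F)%MS)) => // [|S T SF TF].
  by rewrite subrr sub0mx.
have -> : S * T - 1%:M = S *m (T - 1%:M) + (S - 1%:M).
  by rewrite mulmxBr mulmx1 addrA subrK.
by rewrite addmx_sub // (submx_trans (submxMl _ _)).
Qed.

Lemma prod_sub1_cols (I : Type) (r : seq I) m d (A : I -> 'M[C]_d) (X : 'M[C]_(d, m)) :
  (forall i, exists B, A i - 1%:M = X *m B) -> exists B, \prod_(i <- r) A i - 1%:M = X *m B.
Proof.
move=> AX; apply: (big_ind (fun T : 'M_d => exists B, T - 1%:M = X *m B)) => // [|S T [B SB] [E TE]].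
  by exists 0; rewrite subrr mulmx0.
exists (B *m T + E); rewrite mulmxDr mulmxA -SB -TE mulmxBl mul1mx.
by rewrite addrA subrK.
Qed.

Lemma eval_word_alpha_prod (G : Type) d l (rho : G -> 'M[C]_d) (a : 'I_l -> G) :
  eval_word rho (alpha_prod a) = \prod_(i <- enum 'I_l) rho (a i).
Proof.
rewrite /alpha_prod; elim: (enum _) => [|i r IHr] /=; first by rewrite big_nil.
by rewrite big_cons IHr expr1.
Qed.

Lemma eval_word1 (G : Type) d (rho : G -> 'M[C]_d) g :
  eval_word rho [:: (g, 1 : int)] = rho g.
Proof. by rewrite /= expr1 mulmx1. Qed.

Lemma prod_mxE (G : Type) d d' (A : G -> 'M[C]_d) (B : G -> 'M[C]_d') (r : seq G)
    (P : 'M[C]_(d, d')) : (forall i, A i *m P = P *m B i) ->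
  (\prod_(i <- r) A i) *m P = P *m (\prod_(i <- r) B i).
Proof.
move=> AB; elim: r => [|i r IHr]; first by rewrite !big_nil [LHS]mul1mx [RHS]mulmx1.
by rewrite !big_cons -[LHS]mulmxA IHr mulmxA AB -mulmxA.
Qed.

Lemma det_prodmx (I : Type) d (A : I -> 'M[C]_d) (r : seq I) :
  \det (\prod_(i <- r) A i) = \prod_(i <- r) \det (A i).
Proof.
apply: (big_morph (fun M : 'M_d => \det M) _ (det1 _ _)) => S T.
exact: det_mulmx.
Qed.

(** The row [y] is an eigenvector for [b], and the rows killed by [x] are eigenvectors for [a]; as
    [y x] is nonzero, [y] and [m] independent rows of the second kind form a basis. *)
Lemma scalar_outer_diag m (a b : C) (x : 'cV[C]_m.+1) (y : 'rV[C]_m.+1) :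
  (y *m x) 0 0 = b - a -> a != b -> exists2 Z : 'M[C]_(1 + m), Z \in unitmx &
  Z *m (a%:M + x *m y) = block_mx b%:M 0 0 a%:M *m Z.
Proof.
move=> yx ab.
have rx : (m <= \rank (kermx x))%N.
  rewrite mxrank_ker leq_subRL; last exact: rank_leq_row.
  exact: leq_add (rank_leq_col x) (leqnn m).
have [K rK Kx] : exists2 K : 'M[C]_(m, m.+1), row_free K & K *m x = 0.
  exists (pid_mx m *m row_base (kermx x)).
    rewrite /row_free mxrankMfree ?row_base_free // rank_pid_mx //.
  by apply/sub_kermxP; rewrite (submx_trans (submxMl _ _)) // eq_row_base.
have Z0 : row_free (col_mx y K : 'M_(1 + m)).
  apply: inj_row_free => v; rewrite -[v]hsubmxK mul_row_col => E.
  have := congr1 (mulmx^~ x) E; rewrite /= mulmxDl -!mulmxA Kx mulmx0 addr0 mul0mx.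
  rewrite [y *m x]mx11_scalar yx mul_mx_scalar => /eqP.
  rewrite scaler_eq0 subr_eq0 eq_sym (negPf ab) => /eqP v0.
  move: E; rewrite v0 mul0mx add0r => /eqP; rewrite mulmx_free_eq0 // => /eqP ->.
  by rewrite row_mx0.
exists (col_mx y K); first by rewrite -row_free_unit.
rewrite mul_block_col !mul0mx addr0 add0r mul_col_mx !mulmxDr !mulmxA Kx mul0mx addr0.
rewrite [y *m x]mx11_scalar yx !mul_mx_scalar !mul_scalar_mx.
by rewrite -scalerDl addrC subrK.
Qed.

End Reflections.

(** * Pseudo-reflections with a product close to a scalar *)

Section Disc.
Variable C : fieldType.

Lemma enum_ord_split l (j : 'I_l) : exists r1 r2 : seq 'I_l,
  [/\ enum 'I_l = r1 ++ j :: r2, forall i, i \in r1 -> (i < j)%N &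
      forall i, i \in r2 -> (j < i)%N].
Proof.
have : pairwise ltn (map val (enum 'I_l)).
  by rewrite val_enum_ord -sorted_pairwise ?iota_ltn_sorted //; exact: ltn_trans.
have := mem_enum 'I_l j; rewrite inE; move: (enum 'I_l) => r.
case/splitPr=> r1 r2; rewrite pairwise_map pairwise_cat /= => /and3P[/allrelP h1 _ /andP[/allP h2 _]].
exists r1, r2; split=> // i ir.
by apply: (h1 i j) => //; rewrite mem_head.
Qed.

Definition coord_refl l (U : 'M[C]_l) (i : 'I_l) : 'M[C]_l :=
  1%:M + col i U *m delta_mx 0 i.

Definition upper l (U : 'M[C]_l) : 'M[C]_l :=
  \matrix_(i, j) if (i < j)%N then U i j else 0.

Lemma coord_reflE l (U : 'M[C]_l) i (v : 'cV_l) :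
  coord_refl U i *m v = v + v i 0 *: col i U.
Proof.
rewrite mulmxDl mul1mx -mulmxA; congr (_ + _).
by rewrite -rowE [row i v]mx11_scalar mxE mul_mx_scalar.
Qed.

(* Column [j] of [1 - upper U] is fixed by the factors with index [> j]; the [j]-th factor adds
   [col j U] and clears the entries above [j], which makes it fixed by the remaining factors. *)
Lemma prod_coord_refl l (U : 'M[C]_l) :
  (\prod_(i <- enum 'I_l) coord_refl U i) *m (1%:M - upper U) = 1%:M + U - upper U.
Proof.
have fixP (r : seq 'I_l) (v : 'cV_l) : (forall i, i \in r -> v i 0 = 0) ->
    (\prod_(i <- r) coord_refl U i) *m v = v.
  elim: r => [|i r IHr] v0; first by rewrite big_nil [LHS]mul1mx.
  rewrite big_cons -[LHS]mulmxA IHr => [|k kr]; last by rewrite v0 // inE kr orbT.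
  by rewrite coord_reflE v0 ?mem_head // scale0r addr0.
apply: trmx_inj; apply/row_matrixP => j; rewrite -!tr_col; congr trmx.
rewrite [LHS]colE -mulmxA -colE.
have [r1 [r2 [-> lt1 lt2]]] := enum_ord_split j.
rewrite big_cat big_cons /= -mulmxA -[in LHS]mulmxA (fixP r2) => [|i /lt2 ji]; last first.
  by rewrite !mxE -val_eqE /= (gtn_eqF ji) ltnNge (ltnW ji) /= subr0.
rewrite coord_reflE fixP => [|i /lt1 ij]; last first.
  by rewrite !mxE ij ltnn subr0 eqxx mul1r -val_eqE /= (ltn_eqF ij) sub0r addNr.
rewrite !mxE ltnn subr0 eqxx scale1r.
by apply/colP => i; rewrite !mxE addrAC.
Qed.

Lemma det_coord_refl l (U : 'M[C]_l) i : \det (coord_refl U i) = 1 + U i i.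
Proof. by rewrite det_1D_outer -rowE !mxE. Qed.

Lemma unit_1B_upper l (U : 'M[C]_l) : 1%:M - upper U \in unitmx.
Proof.
rewrite -unitmx_tr unitmxE det_trig.
  rewrite big1 ?unitr1 // => i _; rewrite !mxE ltnn eqxx subr0 //.
apply/is_trig_mxP => i j ij.
by rewrite !mxE ltnNge (ltnW ij) -val_eqE /= (gtn_eqF ij) subr0.
Qed.

Section Model.
Variables (m : nat) (lam : 'I_m.+1 -> C) (eta1 eta2 : C).
Hypotheses (lam1 : forall i, lam i != 1) (lam_eta : forall i, lam i != eta1).
Hypotheses (eta1_1 : eta1 != 1) (eta2_1 : eta2 != 1) (eta12 : eta1 != eta2).
Hypotheses (eta1_0 : eta1 != 0) (lam_prod : \prod_i lam i = eta1 ^+ m * eta2).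

Local Notation p i := (lam i - eta1).

(** The matrix [U] with diagonal [lam i - 1] for which [1 + U - N - eta1 (1 - N)], with [N] the
    strictly upper part of [U], is the column of the [p i] times the row of ones. Above the diagonal
    only [eta1 N] survives, whence the division. *)
Definition disc_gram : 'M[C]_m.+1 := \matrix_(i, j)
  if i == j then lam i - 1 else if (j < i)%N then p i else p i / eta1.

(** Comparing determinants, [eta1 ^+ m * (eta1 + y x)] must be [eta1 ^+ m * eta2], so [eta2] is the
    remaining eigenvalue of the product. *)
Let fuchs_disc (A : 'I_m.+1 -> 'M[C]_m.+1) (x : 'cV_m.+1) (y : 'rV_m.+1) :
  (forall i, \det (A i) = lam i) -> \prod_(i <- enum 'I_m.+1) A i = eta1%:M + x *m y ->
  (y *m x) 0 0 = eta2 - eta1.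
Proof.
move=> detA prodA; apply: (addrI eta1); rewrite [RHS]addrC subrK.
apply: (mulfI (expf_neq0 m eta1_0)); rewrite -det_scalar_outer // -prodA det_prodmx.
by rewrite (eq_bigr lam) // big_enum.
Qed.

Let gram_prod : exists y : 'rV[C]_m.+1,
  \prod_(i <- enum 'I_m.+1) coord_refl disc_gram i = eta1%:M + (\col_i p i) *m y.
Proof.
(* Multiplication by [1 - upper disc_gram] turns this row into the row of ones. *)
exists (const_mx 1 *m invmx (1%:M - upper disc_gram)).
apply: (can_inj (mulmxK (unit_1B_upper disc_gram))); rewrite prod_coord_refl.
rewrite mulmxDl mulmxA mulmxKV ?unit_1B_upper //.
apply/matrixP => i j; rewrite mul_scalar_mx !mxE big_ord1 !mxE mulr1.
case: eqVneq => [->|ij]; first by rewrite ltnn !subr0 mulr1 addrCA subrr addr0 addrC subrK.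
case: (ltngtP i j) => [lt|lt|/val_inj/eqP]; last by rewrite (negPf ij).
- by rewrite add0r subrr sub0r mulrN mulrCA divff // mulr1 addNr.
- by rewrite !subr0 mulr0 !add0r.
Qed.

Let Delta : 'M[C]_(1 + m) := block_mx eta2%:M 0 0 eta1%:M.

(* Rescaling the basis dual to the rows of the reflections by the rows of the rank-one matrix
   [prod A_i - eta1] turns every solution into [disc_gram]. *)
Lemma disc_normal_form (A : 'I_m.+1 -> 'M[C]_m.+1) :
  (forall i, (\rank (A i - 1%:M)%R <= 1)%N) -> (forall i, \det (A i) = lam i) ->
  (\rank (\prod_(i <- enum 'I_m.+1) A i - eta1%:M)%R <= 1)%N ->
  exists2 Z : 'M[C]_m.+1, Z \in unitmx & forall i, Z *m A i = coord_refl disc_gram i *m Z.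
Proof.
move=> rA dA rP; have [x [y Pxy]] := rank_le1 rP.
have prodA : \prod_(i <- enum 'I_m.+1) A i = eta1%:M + x *m y by rewrite -Pxy addrC subrK.
have yx := fuchs_disc dA prodA.
have /fin_all_exists[uf ufE] i : exists uf : 'cV[C]_m.+1 * 'rV[C]_m.+1,
    A i = 1%:M + uf.1 *m uf.2.
  have [u [f E]] := rank_le1 (rA i).
  by exists (u, f); rewrite -E addrC subrK.
pose u i := (uf i).1; pose f i := (uf i).2.
pose F := \matrix_i f i.
have Fd i : delta_mx 0 i *m F = f i by rewrite -rowE rowK.
(* Neither [eta1] nor [eta2] is 1, so the product minus 1 is invertible; its row space is contained
   in that of [F]. *)
have uF : F \in unitmx.
  suff : (1%:M <= F)%MS by rewrite sub1mx row_full_unit.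
  have P1 : \prod_(i <- enum 'I_m.+1) A i - 1%:M \in unitmx.
    rewrite prodA addrAC -raddfB unitmxE det_scalar_outer ?subr_eq0 // yx unitfE.
    by rewrite mulf_neq0 ?expf_neq0 ?subr_eq0 // [_ + (_ - _)]addrC addrA subrK subr_eq0.
  have : (\prod_(i <- enum 'I_m.+1) A i - 1%:M <= F)%MS.
    by apply: prod_sub1_rows => i; rewrite ufE addrC addKr -[X in _ *m X]Fd mulmxA submxMl.
  by apply: submx_trans; rewrite sub1mx row_full_unit.
pose U : 'M[C]_m.+1 := \matrix_(i, j) (F *m u j) i 0.
have colU j : col j U = F *m u j by apply/colP => i; rewrite !mxE.
have FA i : F *m A i = coord_refl U i *m F.
  by rewrite ufE mulmxDr mulmx1 mulmxDl mul1mx -mulmxA Fd colU -mulmxA.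
have Uii i : U i i = lam i - 1.
  apply: (addrI 1); rewrite -det_coord_refl [RHS]addrC subrK -dA.
  by apply: det_intertwined (esym (FA i)); rewrite ?row_free_unit ?row_full_unit.
clearbody U; have := prod_coord_refl U.
have -> : \prod_(i <- enum 'I_m.+1) coord_refl U i = eta1%:M + F *m x *m (y *m invmx F).
  rewrite -[LHS](mulmxK uF) (prod_mxE _ (fun i => esym (FA i))) prodA.
  by rewrite mulmxDr mulmxDl scalar_mxC mulmxK // !mulmxA.
set N := 1%:M - upper U; rewrite mulmxDl -[_ *m _ *m N]mulmxA.
move: (y *m _ *m N) => z E; move: (F *m x) E => x' E.
(* Entries of the rank-one matrix [1 + U - upper U - eta1 (1 - upper U)]. The diagonal ones are
   nonzero, hence so is every [z 0 i], and [z] can rescale the basis. *)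
have xz i j : x' i 0 * z 0 j =
    if i == j then lam i - eta1 else if (j < i)%N then U i j else eta1 * U i j.
  have /matrixP/(_ i j) := E; rewrite mul_scalar_mx !mxE big_ord1.
  move/(canRL (addKr _)) ->; case: eqVneq => [<-|ij] /=; rewrite ?ltnn ?Uii; first by ring.
  case: (ltngtP i j) => [lt|lt|/val_inj/eqP]; last by rewrite (negPf ij).
    by ring.
  by ring.
have z0 i : z 0 i != 0.
  by apply: contraNneq (lam_eta i) => zi; have := xz i i; rewrite eqxx zi mulr0 => /esym/eqP; rewrite subr_eq0.
have uD : diag_mx z \in unitmx.
  by rewrite unitmxE det_diag unitfE prodf_seq_neq0; apply/allP => i _; rewrite z0.
exists (diag_mx z *m F); first by rewrite unitmx_mul uD.
have DU : diag_mx z *m U = disc_gram *m diag_mx z.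
  rewrite mul_diag_mx mul_mx_diag; apply/matrixP => i j; rewrite !mxE.
  have := xz i i; rewrite eqxx mulrC => zx; have := xz i j.
  case: eqVneq => [<- _|ij]; first by rewrite Uii mulrC.
  rewrite -zx; case: ltnP => _ xzj; first by rewrite -xzj; ring.
  by rewrite -[U i j](mulKf eta1_0) -xzj; field.
move=> i; rewrite -mulmxA FA !mulmxA; congr (_ *m F).
rewrite mulmxDr mulmx1 mulmxDl mul1mx mulmxA -mulmxA; congr (_ + _).
rewrite -[RHS]mulmxA -rowE row_diag_mx mulmxA.
have -> : diag_mx z *m col i U = z 0 i *: col i disc_gram.
  by rewrite colE mulmxA -colE DU mul_mx_diag; apply/colP => k; rewrite !mxE mulrC.
by rewrite -scalemxAl -scalemxAr.
Qed.

(* All off-diagonal entries of [disc_gram] are nonzero, so a submodule that contains one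
   coordinate vector contains all of them. *)
Lemma disc_gram_irreducible : row_irreducible (coord_refl disc_gram).
Proof.
move=> n V stV.
(* The matrix is the product minus 1, whose eigenvalues are among [eta1 - 1] and [eta2 - 1], times a
   unipotent factor; so no nonzero [V] kills all its columns. *)
have G1 : disc_gram \in unitmx.
  have -> : disc_gram = (\prod_(i <- enum 'I_m.+1) coord_refl disc_gram i - 1%:M) *m
      (1%:M - upper disc_gram).
    by rewrite mulmxBl prod_coord_refl mul1mx opprB addrA subrK addrC addKr.
  rewrite unitmx_mul unit_1B_upper andbT; have [y E] := gram_prod.
  have yx := fuchs_disc (fun i => etrans (det_coord_refl _ i) _) E.
  rewrite E addrAC -raddfB unitmxE det_scalar_outer ?subr_eq0 // yx ?unitfE.
    by rewrite mulf_neq0 ?expf_neq0 ?subr_eq0 // [_ + (_ - _)]addrC addrA subrK subr_eq0.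
  by move=> i; rewrite mxE eqxx addrC subrK.
case: (eqVneq V 0) => [|V0]; [by left | right].
(* [V (A_i - 1)] is the column [V u_i] times the coordinate row [e_i]; a nonzero entry of this
   column puts [e_i] in [V]. *)
have step i : V *m col i disc_gram != 0 -> ((delta_mx 0 i : 'rV[C]_m.+1) <= V)%MS.
  move=> /eqP Vc; have : (V *m col i disc_gram *m delta_mx 0 i <= V)%MS.
    have -> : V *m col i disc_gram *m delta_mx 0 i = V *m coord_refl disc_gram i - V.
      by rewrite mulmxDr mulmx1 addrC addKr mulmxA.
    by rewrite addmx_sub ?eqmx_opp.
  apply: submx_trans; move/eqP/cV0Pn: Vc; move: (V *m _) => w [k wk].
  have : ((w k 0)^-1 *: row k (w *m delta_mx 0 i) <= w *m delta_mx 0 i)%MS.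
    exact: scalemx_sub (row_sub _ _).
  by rewrite row_mul [row k w]mx11_scalar mul_scalar_mx scalerA mxE mulVf // scale1r.
have [i Vi] : exists i, V *m col i disc_gram != 0.
  apply/existsP; apply: contraNT V0; rewrite negb_exists => /forallP V0.
  rewrite -[V](mulmxK G1) -(rwP eqP); suff -> : V *m disc_gram = 0 by rewrite mul0mx.
  apply: trmx_inj; apply/row_matrixP => j; rewrite -tr_col colE -mulmxA -colE.
  by have := V0 j; rewrite negbK => /eqP ->; rewrite !trmx0 row0.
have Vdelta := step _ Vi; rewrite -sub1mx; apply/row_subP => j; rewrite row1.
have [->//|ij] := eqVneq j i; apply: step.
have /submxP[v iE] := Vdelta; apply: contraTneq isT => Vj.
have : (delta_mx 0 i *m col j disc_gram : 'rV_1) = 0 by rewrite iE -mulmxA Vj mulmx0.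
rewrite -rowE => /matrixP/(_ 0 0); rewrite !mxE eq_sym (negPf ij).
by case: ifP => _ /eqP; rewrite ?mulf_eq0 ?invr_eq0 ?(negPf eta1_0) subr_eq0 ?orbF (negPf (lam_eta _)).
Qed.

(** The basis is changed so that the product is diagonal with [eta2] first: this is how [alpha] acts
    on its image in [G (+) F^m], where the reflections are to be glued in. *)
Lemma disc_system : exists A0 : 'I_m.+1 -> 'M[C]_(1 + m),
  [/\ forall i, \rank (A0 i - 1%:M)%R = 1%N, forall i, \det (A0 i) = lam i,
      \prod_(i <- enum 'I_m.+1) A0 i = block_mx eta2%:M 0 0 eta1%:M,
      row_irreducible A0 &
      forall A : 'I_m.+1 -> 'M[C]_(1 + m), (forall i, (\rank (A i - 1%:M)%R <= 1)%N) ->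
        (forall i, \det (A i) = lam i) ->
        (\rank (\prod_(i <- enum 'I_m.+1) A i - eta1%:M)%R <= 1)%N ->
        exists2 Z : 'M[C]_(1 + m), Z \in unitmx & forall i, Z *m A i = A0 i *m Z].
Proof.
have dG i : \det (coord_refl disc_gram i) = lam i.
  by rewrite det_coord_refl mxE eqxx addrC subrK.
have [y E] := gram_prod; have yx := fuchs_disc dG E.
have [Z uZ ZP] := scalar_outer_diag yx eta12.
pose A0 i := Z *m coord_refl disc_gram i *m invmx Z.
have ZA0 i : Z *m coord_refl disc_gram i = A0 i *m Z by rewrite mulmxKV.
have fZ : row_free Z by rewrite row_free_unit.
have uuZ : row_full Z by rewrite row_full_unit.
exists A0; split.
- move=> i; transitivity (\rank (coord_refl disc_gram i - 1%:M)).
    apply: (mxrank_intertwined fZ uuZ).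
    by rewrite mulmxBl mulmxBr -ZA0 mulmx1 mul1mx.
  apply/eqP; rewrite /coord_refl addrC addKr eqn_leq mxrank_outer lt0n mxrank_eq0.
  apply: contraNneq (lam1 i) => c0; rewrite -dG /coord_refl c0 addr0 det1 //.
- by move=> i; rewrite -dG; apply: (det_intertwined fZ uuZ (esym (ZA0 i))).
- rewrite -[LHS](mulmxK uZ) (prod_mxE _ (fun i => esym (ZA0 i))) E ZP.
  by rewrite mulmxK.
- apply: (@row_irreducible_conj _ _ _ (coord_refl disc_gram) _ (invmx Z)) => //.
  + by rewrite unitmx_inv.
  + by move=> i; rewrite /A0 !mulmxA mulVmx // mul1mx.
  exact: disc_gram_irreducible.
move=> A rA dA rP; have [Z1 uZ1 Z1P] := disc_normal_form rA dA rP.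
exists (Z *m Z1); first by rewrite unitmx_mul uZ.
by move=> i; rewrite -mulmxA Z1P !mulmxA ZA0.
Qed.
End Model.
End Disc.

(** * Companion matrices *)

Section Hypergeometric.
Variable C : fieldType.

(** For [p] monic of degree [d], multiplication by X on [C[X]/(p)] in the basis of powers of X,
    acting on rows. [krylov] is then the matrix of the map sending X^i to [v A^i]. *)
Definition companion d (p : {poly C}) : 'M[C]_d :=
  \matrix_(i, j) if i.+1 == d then - p`_j else (i.+1 == j)%:R.

Definition krylov d N (A : 'M[C]_N) (v : 'rV[C]_N) : 'M[C]_(d, N) :=
  \matrix_(i < d) (v *m A ^+ i).

Lemma companion_krylov d N (A : 'M[C]_N) (v : 'rV_N) p :
  p \is monic -> size p = d.+1 -> v *m evm A p = 0 ->
  companion d p *m krylov d A v = krylov d A v *m A.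
Proof.
move=> mp sp vp; apply/row_matrixP => i; rewrite !row_mul rowK -mulmxA -expmxSr.
(* Only the last row uses that [p(A)] kills [v]; the others are shifted. *)
rewrite mulmx_sum_row; have [id|id] := eqVneq i.+1 d.
  rewrite [X in _ = _ *m A ^+ X]id.
  move: vp; rewrite evm_monic_split // sp /= mulmxDr => /eqP.
  rewrite addrC addr_eq0 => /eqP ->; rewrite mulmx_sumr -sumrN.
  by apply: eq_bigr => j _; rewrite !mxE id eqxx rowK scaleNr scalemxAr.
have lt : (i.+1 < d)%N by rewrite ltn_neqAle id ltn_ord.
rewrite (bigD1 (Ordinal lt)) //= big1 => [|j]; rewrite !mxE rowK (negPf id).
  by rewrite eqxx scale1r addr0.
by rewrite -val_eqE /= eq_sym => /negPf->; rewrite scale0r.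
Qed.

Definition poly_of (s : seq C) : {poly C} := \prod_(x <- s) ('X - x%:P).

(** The all-ones row is cyclic for [diag_of s]: its Krylov matrix is a Vandermonde matrix,
    invertible for distinct entries. *)
Lemma conjugate_companion d s : size s = d -> uniq s ->
  conjugate (companion d (poly_of s)) (diag_of s).
Proof.
move=> <- us; set v : 'rV[C]_(size s) := const_mx 1.
pose a : 'rV[C]_(size s) := \row_i s`_i.
have VE : krylov (size s) (diag_of s) v = Vandermonde (size s) a.
  apply/matrixP => i j; rewrite !mxE.
  have -> : (diag_of s : 'M[C]_(size s)) ^+ i = diag_mx (\row_j s`_j ^+ i).
    elim: (i : nat) => [|n IHn].
      by rewrite expr0 [LHS](_ : _ = 1%:M) // -diag_const_mx; congr diag_mx; apply/rowP => k; rewrite !mxE.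
    by rewrite expmxS IHn mul_diag_mx; apply/matrixP => k h; rewrite !mxE mulrnAr exprS.
  rewrite (bigD1 j) //= big1 => [|k kj]; rewrite !mxE ?eqxx ?mulr1n ?mul1r ?addr0 //.
  by rewrite (negPf kj) mulr0n.
have uV : krylov (size s) (diag_of s) v \in unitmx.
  rewrite VE unitmxE det_Vandermonde unitfE prodf_seq_neq0; apply/allP => i _ /=.
  rewrite prodf_seq_neq0; apply/allP => j _; apply/implyP => ij.
  by rewrite !mxE subr_eq0 nth_uniq // gtn_eqF.
exists (krylov (size s) (diag_of s) v); rewrite row_free_unit row_full_unit; split=> //.
apply: companion_krylov; rewrite ?monic_prod_XsubC ?size_prod_XsubC //.
rewrite evm_diag_of; apply/rowP => j; rewrite mul_mx_diag !mxE (rootP _) ?mulr0 //.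
by rewrite root_prod_XsubC mem_nth.
Qed.

Lemma coprime_poly_of p s : (forall x, x \in s -> ~~ root p x) -> coprimep p (poly_of s).
Proof.
move=> ps; rewrite /poly_of; elim: s ps => [|x s IHs] ps.
  by rewrite big_nil coprimep1.
rewrite big_cons coprimepMr IHs => [|y ys]; last by rewrite ps // inE ys orbT.
by rewrite coprimep_XsubC ps // mem_head.
Qed.

Definition pair_of N (A B : 'M[C]_N) (b : bool) := if b then A else B.

(** Write [A - B = x y]. If [U] kills [x], then [A] and [B] agree on [U]; otherwise stability puts
    [y] in [U], and they agree modulo [U]. *)
Lemma hypergeometric_irreducible N (A B : 'M[C]_N) p q :
  coprimep p q -> evm A p = 0 -> evm B q = 0 -> (\rank (A - B)%R <= 1)%N ->
  row_irreducible (pair_of A B).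
Proof.
move=> pq Ap Bq /rank_le1[x [y AB]] m U stU.
have [stA stB] := (stU true, stU false).
have [Ux|/eqP Ux] := eqVneq (U *m x) 0.
  left; apply: (no_common_sub pq Ap Bq stA); apply/eqP.
  by rewrite -subr_eq0 -mulmxBr AB mulmxA Ux mul0mx.
right; apply: (no_common_quotient pq Ap Bq stA).
have yU : (y <= U)%MS.
  have : (U *m x *m y <= U)%MS.
    by rewrite -mulmxA -AB mulmxBr addmx_sub ?eqmx_opp.
  apply: submx_trans; move/eqP/cV0Pn: Ux; move: (U *m x) => w [k wk].
  have : ((w k 0)^-1 *: row k (w *m y) <= w *m y)%MS by exact: scalemx_sub (row_sub _ _).
  by rewrite row_mul [row k w]mx11_scalar mul_scalar_mx scalerA mxE mulVf // scale1r.
by rewrite AB (submx_trans (submxMl _ _)).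
Qed.

Lemma rank_companionB d p q : (\rank (companion d p - companion d q)%R <= 1)%N.
Proof.
case: d => [|d]; first by rewrite [_ - _]flatmx0 mxrank0.
have -> : companion d.+1 p - companion d.+1 q =
    delta_mx ord_max 0 *m (\row_j (q`_j - p`_j)).
  apply/matrixP => i j; rewrite !mxE big_ord1 !mxE andbT eqSS -val_eqE /=.
  by case: eqP => _; rewrite ?mul0r ?mul1r ?subrr // opprK addrC.
exact: mxrank_outer.
Qed.

(** Each of the [n] conditions lowers the dimension by at most [c]. *)
Lemma common_kernel N n (K : nat -> 'M[C]_N) c : (forall j, (\rank (K j) <= c)%N) ->
  exists2 E : 'M[C]_N, (N <= \rank E + n * c)%N & forall j, (j < n)%N -> E *m K j = 0.
Proof.
move=> rK; elim: n => [|n [E rE EK]]; first by exists 1%:M => //; rewrite mxrank1 leq_addr.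
exists (E :&: kermx (K n))%MS => [|j].
  have := mxrank_mul_ker E (K n).
  have := leq_trans (mxrankM_maxr E (K n)) (rK n); move: rE; rewrite mulSn; lia.
rewrite ltnS leq_eqVlt => /orP[/eqP->|jn].
  by apply/sub_kermxP/capmxSr.
by have /submxP[X ->] := capmxSl E (kermx (K n)); rewrite -mulmxA EK // mulmx0.
Qed.

Lemma expmx_agree m N n (A B : 'M[C]_N) (v : 'M[C]_(m, N)) :
  (forall j, (j < n)%N -> v *m (A ^+ j *m (A - B)) = 0) ->
  forall j, (j <= n)%N -> v *m A ^+ j = v *m B ^+ j.
Proof.
move=> vAB; elim=> [|j IHj] jn; first by rewrite !expr0.
have := vAB _ jn; rewrite mulmxBr mulmxBr -expmxSr => /eqP; rewrite subr_eq0 => /eqP ->.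
by rewrite mulmxA IHj ?(ltnW jn) // -mulmxA -expmxSr.
Qed.

Lemma krylov_intertwined d N (A B : 'M[C]_N) (v : 'rV_N) p q :
  p \is monic -> q \is monic -> size p = d.+1 -> size q = d.+1 ->
  (forall j, (j < d.-1)%N -> v *m (A ^+ j *m (A - B)) = 0) ->
  v *m evm A p = 0 -> v *m evm B q = 0 ->
  companion d p *m krylov d A v = krylov d A v *m A /\
  companion d q *m krylov d A v = krylov d A v *m B.
Proof.
move=> mp mq sp sq vAB vp vq; split; first exact: companion_krylov.
have -> : krylov d A v = krylov d B v.
  apply/row_matrixP => i; rewrite !rowK (expmx_agree vAB) //.
  by case: d i {sp sq vAB} => [[]|d] [].
exact: companion_krylov.
Qed.

(** A Krylov matrix with [d] rows sees only powers below [d], so [v A^j = v B^j] is required for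
    [j <= d - 1] only. These are [d - 1] conditions of rank at most [c], leaving a nonzero [v]. *)
Lemma hypergeometric_embedding d N c (A B : 'M[C]_N) p q :
  (0 < d)%N -> p \is monic -> q \is monic -> size p = d.+1 -> size q = d.+1 ->
  evm A p = 0 -> evm B q = 0 -> (\rank (A - B)%R <= c)%N -> (d.-1 * c < N)%N ->
  exists2 phi : 'M[C]_(d, N), phi != 0 &
    companion d p *m phi = phi *m A /\ companion d q *m phi = phi *m B.
Proof.
move=> d0 mp mq sp sq Ap Bq rAB cN.
have [j|E rE EK] := @common_kernel N d.-1 (fun j => A ^+ j *m (A - B)) c.
  exact: leq_trans (mxrankM_maxr _ _) rAB.
have /rowV0Pn[v /submxP[X vE] v0] : E != 0.
  by rewrite -mxrank_eq0 -lt0n; lia.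
exists (krylov d A v).
  apply: contraNneq v0 => /(congr1 (row (Ordinal d0))).
  by rewrite rowK expr0 row0 => /(etrans (esym (mulmx1 v))) ->.
apply: krylov_intertwined => // [j jd||]; rewrite ?Ap ?Bq ?mulmx0 //.
by rewrite vE -mulmxA EK ?mulmx0.
Qed.

Lemma row_irreducible_free (I : Type) d N (f : I -> 'M[C]_d) (A : I -> 'M[C]_N)
    (phi : 'M[C]_(d, N)) :
  row_irreducible f -> (forall i, f i *m phi = phi *m A i) -> phi != 0 -> row_free phi.
Proof.
move=> irr fA phi0; have stK i : stablemx (kermx phi) (f i).
  by apply/sub_kermxP; rewrite -mulmxA fA mulmxA mulmx_ker mul0mx.
have [K0|] := irr _ _ stK; first by rewrite -kermx_eq0 K0.
rewrite row_full_unit => Ku; case/negP: phi0; apply/eqP.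
by rewrite -[phi](mulKmx Ku) mulmx_ker mulmx0.
Qed.

End Hypergeometric.

(** * Representations of turbine groups *)

Section Turbines.
Variable C : fieldType.

Lemma codim_fixed d (M : 'M[C]_d) : codim (fixed_mx M) = \rank (M - 1%:M).
Proof. by rewrite /codim /fixed_mx mxrank_ker mxrank_tr subKn // rank_leq_row. Qed.

Lemma sub_fixed m d (M : 'M[C]_d) (K : 'M[C]_(m, d)) :
  (K <= fixed_mx M)%MS <-> M *m K^T = K^T.
Proof.
split=> [/sub_kermxP E|E].
  apply: trmx_inj; rewrite trmx_mul trmxK; apply/eqP; rewrite -subr_eq0.
  by rewrite -{2}[K]mulmx1 -mulmxBr -trmx1 -raddfB /= E.
apply/sub_kermxP; apply: trmx_inj.
by rewrite trmx_mul trmxK mulmxBl mul1mx E subrr trmx0.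
Qed.

Lemma pseudo_reflectionE d (M : 'M[C]_d) a : a != 0 -> a != 1 ->
  (pseudo_reflection M /\ special_eigenvalue M = a) <->
  (\rank (M - 1%:M)%R = 1%N /\ \det M = a).
Proof.
rewrite /pseudo_reflection /special_eigenvalue codim_fixed => a0 a1.
split=> [[[_ r1 _] dM]|[r1 dM]] //; split=> //; split=> //; last by rewrite dM.
by rewrite unitmxE unitfE dM.
Qed.

Lemma mxpowz_scalar d (a : C) z : mxpowz (a%:M : 'M_d) z = (a ^ z)%:M.
Proof.
have E n : (a%:M : 'M_d) ^+ n = (a ^+ n)%:M.
  elim: n => [|n IHn]; first by rewrite !expr0.
  by rewrite expmxS IHn -scalar_mxM exprS.
by case: z => n /=; rewrite ?invmx_scalar E ?invmx_scalar.
Qed.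

Lemma mxpowzN d (A : 'M[C]_d) n : mxpowz A (- n%:Z) = invmx (A ^+ n).
Proof. by case: n => [|n] //=; rewrite expr0 [RHS]invmx1. Qed.

Definition turbine_mon l d (a : 'I_l -> 'M[C]_d) (o0 oi : 'M[C]_d) (eps : C)
    (g : turbine_gen l) : 'M[C]_d :=
  match g with
  | Alpha i => a i
  | Omega0 => o0
  | OmegaInf => oi
  | Delta => eps%:M
  end.

Lemma turbine_shaft_rep l d (a : 'I_l -> 'M[C]_d) o0 oi eps :
  (forall i, a i \in unitmx) -> o0 \in unitmx -> oi \in unitmx -> eps != 0 ->
  (\prod_(i <- enum 'I_l) a i) *m oi = o0 ->
  is_representation (X := turbine_shaft l) (turbine_mon a o0 oi eps).
Proof.
move=> ua u0 ui eps0 ao; split=> [[i|||] /=|u v []]; first exact: ua; rewrite ?u0 ?ui //.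
- by rewrite unitmxE det_scalar unitrX ?unitfE.
- by rewrite eval_word_cat eval_word_alpha_prod !eval_word1 /= ao.
by move=> g; rewrite /= !expr1 !mulmx1 scalar_mxC.
Qed.

Lemma mon_shaft l (L : local_system C (turbine_shaft l)) :
  (\prod_(i <- enum 'I_l) mon L (Alpha i)) *m mon L (OmegaInf l) = mon L (Omega0 l).
Proof.
have [_ /(_ _ _ (shaft_rel_prod l))] := monP L.
by rewrite eval_word_cat eval_word_alpha_prod !eval_word1.
Qed.

Lemma mon_bare k r l (L : local_system C (turbine k r l)) :
  (\prod_(i <- enum 'I_l) mon L (Alpha i)) *m mon L (OmegaInf l) = mon L (Omega0 l).
Proof.
have [_ /(_ _ _ (shaft_rel_prod l))] := shaft_of_bare (monP L).
by rewrite eval_word_cat eval_word_alpha_prod !eval_word1.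
Qed.

Lemma mon_bare_pow k r l (L : local_system C (turbine k r l)) eps :
  mon L (Delta l) = eps%:M -> mon L (Omega0 l) ^+ k = (eps ^ r)%:M.
Proof.
move=> De; have [_ /(_ _ _ (bare_rel_pow k r l))] := monP L.
by rewrite /= !mulmx1 De mxpowz_scalar.
Qed.

Lemma blade_loopE k l d (rho : turbine_gen l -> 'M[C]_d) (i : 'I_l) (j : 'I_k) :
  eval_word rho (blade_loop (i, j)) =
    rho (Omega0 l) ^+ (k - 1 - j) *m rho (Alpha i) *m invmx (rho (Omega0 l) ^+ (k - 1 - j)).
Proof.
rewrite /= expr1 mulmx1.
have -> : k%:Z - 1 - (j : nat)%:Z = (k - 1 - j)%N%:Z by have := ltn_ord j; lia.
have -> : 1 - k%:Z + (j : nat)%:Z = - (k - 1 - j)%N%:Z by have := ltn_ord j; lia.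
by rewrite mxpowzN mulmxA.
Qed.

Lemma alpha0_loopE k r l d (rho : turbine_gen l -> 'M[C]_d) eps :
  rho (Delta l) = eps%:M -> eval_word rho (alpha0_loop k r l) =
  eps ^ r *: invmx (rho (Omega0 l) ^+ k).
Proof.
by move=> De; rewrite /= mulmx1 De mxpowz_scalar mxpowzN mul_scalar_mx.
Qed.

Lemma rank_conjB1 d (A B : 'M[C]_d) : B \in unitmx ->
  \rank (B *m A *m invmx B - 1%:M) = \rank (A - 1%:M).
Proof.
move=> uB; apply/esym; apply: (@mxrank_intertwined _ _ _ _ _ (invmx B)).
- by rewrite row_free_unit unitmx_inv.
- by rewrite row_full_unit unitmx_inv.
by rewrite mulmxBl mulmxBr !mulmxA mulVmx // mul1mx mulmx1 mul1mx.
Qed.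

Lemma codim_blade_loop k l (L : local_system C (turbine_shaft l)) (i : 'I_l) (j : 'I_k) :
  codim (fixed_mx (eval_word (mon L) (blade_loop (i, j)))) =
  \rank (mon L (Alpha i) - 1%:M).
Proof.
by rewrite codim_fixed blade_loopE rank_conjB1 // mx_expr_unit //; case: (monP L).
Qed.

(** Multiplying [eps^r Omega0^-k - 1] by the invertible [Omega0^k] gives [eps^r - Omega0^k]. *)
Lemma codim_alpha0_loop k r l (L : local_system C (turbine_shaft l)) eps :
  mon L (Delta l) = eps%:M ->
  codim (fixed_mx (eval_word (mon L) (alpha0_loop k r l))) =
  \rank (mon L (Omega0 l) ^+ k - (eps ^ r)%:M).
Proof.
move=> De; rewrite codim_fixed (alpha0_loopE _ _ De).
have uO : mon L (Omega0 l) ^+ k \in unitmx by rewrite mx_expr_unit //; case: (monP L).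
have fO : row_free (mon L (Omega0 l) ^+ k) by rewrite row_free_unit.
rewrite -(mxrankMfree _ fO) mulmxBl mul1mx -scalemxAl mulVmx // scalemx1.
by rewrite -opprB mxrank_opp.
Qed.

Lemma expmxV d (A : 'M[C]_d) n : invmx A ^+ n = invmx (A ^+ n).
Proof.
case: d A => [|d] A; first by rewrite [LHS]flatmx0 [RHS]flatmx0.
by have := exprVn A n; rewrite /GRing.inv /=.
Qed.

(* The hypotheses make [B^-j] and [A^-j] agree on [V] for every [j], so the annihilating
   polynomial of [B] would kill [V] also when evaluated at [A]. *)
Lemma pochhammer_core d n (A B T : 'M[C]_d) (V : 'M[C]_(d, n)) k e p q :
  A \in unitmx -> B \in unitmx -> T *m B = A -> e != 0 -> (0 < k)%N ->
  coprimep p q -> evm A p = 0 -> evm B q = 0 ->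
  A ^+ k *m V = e *: V ->
  (forall j, (j < k)%N -> T *m (invmx (A ^+ j) *m V) = invmx (A ^+ j) *m V) ->
  V = 0.
Proof.
move=> uA uB TB e0 k0 pq Ap Bq AkV TV.
have AV j : invmx (A ^+ (j + k)) *m V = e^-1 *: (invmx (A ^+ j) *m V).
  rewrite -expmxV exprD -[_ * _]/(invmx A ^+ j *m invmx A ^+ k) -mulmxA !expmxV.
  rewrite scalemxAr; congr (_ *m _); apply: (canLR (mulKmx (mx_expr_unit _ uA))).
  by rewrite -scalemxAr AkV scalerA mulVf // scale1r.
(* Powers of [A] differing by [k] act proportionally on [V], so the [k] given conditions extend to
   all [j]. *)
have {}TV j : T *m (invmx (A ^+ j) *m V) = invmx (A ^+ j) *m V.
  elim/ltn_ind: j => j IHj; have [/TV//|kj] := ltnP j k.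
  by rewrite -(subnK kj) AV -scalemxAr IHj // ltn_subrL k0 (leq_trans k0).
have BV j : invmx (B ^+ j) *m V = invmx (A ^+ j) *m V.
  elim: j => [|j IHj]; first by rewrite !expr0.
  have BT : invmx B = invmx A *m T by rewrite -[RHS](mulmxK uB) -(mulmxA _ T) TB mulVmx // mul1mx.
  by rewrite -!expmxV !expmxS -!mulmxA !expmxV IHj BT -mulmxA TV.
(* Dividing [q] by X^(size q) leaves only negative powers, the ones that [BV] compares. *)
have powB (M : 'M[C]_d) i : M \in unitmx -> (i < size q)%N ->
    invmx (M ^+ size q) *m M ^+ i = invmx (M ^+ (size q - i)).
  move=> uM iq; apply: (canLR (mulKmx (mx_expr_unit _ uM))).
  rewrite -{1}(subnKC (ltnW iq)) exprD -[_ * _]/(M ^+ i *m M ^+ (size q - i)).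
  by rewrite mulmxK // mx_expr_unit.
have uq := evm_coprime_unit pq Ap.
have E : invmx (A ^+ size q) *m evm A q *m V = invmx (B ^+ size q) *m evm B q *m V.
  rewrite /evm !mulmx_sumr !mulmx_suml; apply: eq_bigr => i _.
  by rewrite -!scalemxAr -!scalemxAl !powB // BV.
rewrite Bq mulmx0 mul0mx in E.
have uM : invmx (A ^+ size q) *m evm A q \in unitmx.
  by rewrite unitmx_mul uq unitmx_inv mx_expr_unit.
by rewrite -[V](mulKmx uM) E mulmx0.
Qed.

End Turbines.

(** * The Pochhammer condition *)

Section Pochhammer.
Variable C : fieldType.

Lemma big_option_nat (I : finType) (F : option I -> nat) :
  (\sum_o F o = F None + \sum_i F (Some i))%N.
Proof.
rewrite (bigD1 None) //=; congr (_ + _)%N.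
rewrite (reindex_omap Some id) => [|[]//].
by apply: eq_bigl => i; rewrite /= eqxx.
Qed.

Lemma prod_fixed (I : eqType) d n (A : I -> 'M[C]_d) (V : 'M[C]_(d, n)) (r : seq I) :
  (forall i, A i *m V = V) -> (\prod_(i <- r) A i) *m V = V.
Proof.
move=> AV; elim: r => [|i r IHr]; first by rewrite big_nil [LHS]mul1mx.
by rewrite big_cons -[LHS]mulmxA IHr AV.
Qed.

Lemma blade_loops_fixed k l d n (rho : turbine_gen l -> 'M[C]_d) (V : 'M[C]_(d, n)) :
  rho (Omega0 l) \in unitmx ->
  (forall ij : 'I_l * 'I_k, eval_word rho (blade_loop ij) *m V = V) ->
  forall j, (j < k)%N -> (\prod_(i <- enum 'I_l) rho (Alpha i)) *m
     (invmx (rho (Omega0 l) ^+ j) *m V) = invmx (rho (Omega0 l) ^+ j) *m V.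
Proof.
move=> uO VF j jk; apply: prod_fixed => i.
have uOj := mx_expr_unit j uO.
(* The loop of index [k - 1 - j] conjugates by the power [j]. *)
have lt : (k - 1 - j < k)%N by lia.
have := VF (i, Ordinal lt); rewrite blade_loopE /=.
have -> : (k - 1 - (k - 1 - j) = j)%N by lia.
by rewrite -!mulmxA => /(canRL (mulKmx uOj)).
Qed.

Lemma codim_line_shaft k r l (L : local_system C (turbine_shaft l)) eps :
  mon L (Delta l) = eps%:M ->
  (\sum_c codim (fixed_mx (mon (restriction (line_shaft C k r l) L) c)) =
   \rank (mon L (Omega0 l) ^+ k - (eps ^ r)%:M)%R +
   k * \sum_i \rank (mon L (Alpha i) - 1%:M)%R)%N.
Proof.
move=> De; rewrite big_option_nat; congr (_ + _)%N; first exact: codim_alpha0_loop.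
rewrite (eq_bigr (fun ij : 'I_l * 'I_k => \rank (mon L (Alpha ij.1) - 1%:M))).
  rewrite -(pair_bigA _ (fun i _ => \rank (mon L (Alpha i) - 1%:M))) /= big_distrr /=.
  by apply: eq_bigr => i _; rewrite sum_nat_const card_ord.
by case=> i j _; exact: codim_blade_loop.
Qed.

Lemma pochhammer_shaft_intro k r l (L : local_system C (turbine_shaft l)) eps p q :
  (0 < k)%N -> eps != 0 -> mon L (Delta l) = eps%:M ->
  coprimep p q -> evm (mon L (Omega0 l)) p = 0 -> evm (mon L (OmegaInf l)) q = 0 ->
  \rank (mon L (Omega0 l) ^+ k - (eps ^ r)%:M)%R = 1%N ->
  rank L = (1 + k * \sum_i \rank (mon L (Alpha i) - 1%:M)%R)%N ->
  pochhammer_shaft k r L.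
Proof.
move=> k0 eps0 De pq Op Oq r1 rL; have [uL _] := monP L.
split; first by rewrite (codim_line_shaft k r De) r1.
apply/andP; split; last exact: sub0mx.
set W := mon (restriction (line_shaft C k r l) L).
pose U := (\bigcap_i fixed_mx (W i))%MS; rewrite -/U.
have VF i : W i *m U^T = U^T by apply/sub_fixed; apply: bigcapmx_inf (submx_refl _).
suff U0 : U^T = 0 by rewrite -[U]trmxK U0 trmx0 sub0mx.
have er0 : eps ^ r != 0 by rewrite expfz_neq0.
apply: (@pochhammer_core C _ _ (mon L (Omega0 l)) (mon L (OmegaInf l))
    (\prod_(i <- enum 'I_l) mon L (Alpha i)) _ k (eps ^ r) p q) => //; first exact: mon_shaft.
  (* Being fixed by [alpha_0] means [Omega0^k V = eps^r V]. *)
  have := VF None; rewrite [W None](alpha0_loopE _ _ De) -scalemxAl => {1}<-.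
  by rewrite -scalemxAr (mulKVmx (mx_expr_unit _ (uL _))).
by apply: blade_loops_fixed => // ij; exact: VF (Some ij).
Qed.

(** Without the shaft, [Omega0^k V = eps^r V] comes from the relation [omega_0^k = delta^r] instead
    of [alpha_0]. *)
Lemma pochhammer_bare_intro k r l (L : local_system C (turbine k r l)) eps p q :
  (0 < k)%N -> eps != 0 -> mon L (Delta l) = eps%:M ->
  coprimep p q -> evm (mon L (Omega0 l)) p = 0 -> evm (mon L (OmegaInf l)) q = 0 ->
  (forall i, \rank (mon L (Alpha i) - 1%:M)%R = 1%N) -> rank L = (k * l)%N ->
  pochhammer1_bare L.
Proof.
move=> k0 eps0 De pq Op Oq r1 rL; have [uL _] := monP L.
have c1 ij : codim (fixed_mx (mon (restriction (line_bare C k r l) L) ij)) = 1%N.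
  case: ij => i j; rewrite codim_fixed [mon _ _]blade_loopE rank_conjB1 ?r1 //.
  exact: mx_expr_unit.
split=> //; split.
  rewrite [LHS]rL (eq_bigr (fun=> 1%N)) // sum_nat_const card_prod !card_ord.
  by rewrite muln1 mulnC.
apply/andP; split; last exact: sub0mx.
set W := mon (restriction (line_bare C k r l) L).
pose U := (\bigcap_i fixed_mx (W i))%MS; rewrite -/U.
have VF i : W i *m U^T = U^T by apply/sub_fixed; apply: bigcapmx_inf (submx_refl _).
suff U0 : U^T = 0 by rewrite -[U]trmxK U0 trmx0 sub0mx.
apply: (@pochhammer_core C _ _ (mon L (Omega0 l)) (mon L (OmegaInf l))
    (\prod_(i <- enum 'I_l) mon L (Alpha i)) _ k (eps ^ r) p q) => //.
- exact: mon_bare.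
- by rewrite expfz_neq0.
- by rewrite (mon_bare_pow De) mul_scalar_mx.
exact: blade_loops_fixed.
Qed.

Lemma irreducible_rows X (L : local_system C X) :
  (0 < rank L)%N -> row_irreducible (mon L) -> irreducible L.
Proof. by move=> L0 irr; split=> // U; exact: row_irreducible_tr. Qed.

Lemma row_irreducible_sub (I J : Type) d (A : I -> 'M[C]_d) (B : J -> 'M[C]_d) :
  (forall j, exists i, B j = A i) -> row_irreducible B -> row_irreducible A.
Proof.
move=> BA irr m U stU; apply: irr => j; have [i ->] := BA j; exact: stU.
Qed.

Lemma restriction_boundary_shaft l (L M : local_system C (turbine_shaft l)) c :
  isomorphic (restriction (boundary_shaft C c) M) (restriction (boundary_shaft C c) L) ->
  let g := match c with Inner => Omega0 l | Outer => OmegaInf l | Blade i => Alpha i end in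
  conjugate (mon M g) (mon L g) /\
  forall a, mon L (Delta l) = a%:M -> mon M (Delta l) = a%:M.
Proof.
move=> /isomorphic_sym[P [fP uP PE]]; split=> [|a La].
  apply: conjugate_sym; exists P; split=> //.
  have := PE Transverse; case: c {PE} P fP uP => [||i] P fP uP /=;
    by rewrite !expr1 !mulmx1.
have := PE Fibre; rewrite /= !expr1 !mulmx1 La.
exact: scalar_intertwined.
Qed.

Lemma restriction_boundary_bare k r l (L M : local_system C (turbine k r l)) c :
  isomorphic (restriction (boundary_bare C k r c) M) (restriction (boundary_bare C k r c) L) ->
  let g := match c with Inner => Omega0 l | Outer => OmegaInf l | Blade i => Alpha i end in
  conjugate (mon M g) (mon L g) /\
  forall a, mon L (Delta l) = a%:M -> mon M (Delta l) = a%:M.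
Proof.
move=> /isomorphic_sym[P [fP uP PE]]; split=> [|a La].
  apply: conjugate_sym; exists P; split=> //.
  have := PE Transverse; case: c {PE} P fP uP => [||i] P fP uP /=;
    by rewrite !expr1 !mulmx1.
have := PE Fibre; rewrite /= !expr1 !mulmx1 La.
exact: scalar_intertwined.
Qed.

Lemma conjugate_rankB1 d d' (A : 'M[C]_d) (B : 'M[C]_d') :
  conjugate A B -> \rank (A - 1%:M) = \rank (B - 1%:M).
Proof.
case=> P [fP uP APB]; apply: (mxrank_intertwined fP uP).
by rewrite mulmxBl mulmxBr APB mul1mx mulmx1.
Qed.

End Pochhammer.

(** * Inflation and powers of a local system *)

Section Inflation.
Variable C : fieldType.

(* When [Y D = 1], row vectors split as [ker D] plus the row space of [Y]; [inflate D Y A] is the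
   identity on the first summand and [A] on the second. *)
Definition inflate d n (D : 'M[C]_(d, n)) (Y : 'M[C]_(n, d)) (A : 'M[C]_n) : 'M[C]_d :=
  1%:M + D *m (A - 1%:M) *m Y.

Section Theory.
Variables (d n : nat) (D : 'M[C]_(d, n)) (Y : 'M[C]_(n, d)).
Hypothesis YD : Y *m D = 1%:M.

Lemma inflate_row A : Y *m inflate D Y A = A *m Y.
Proof. by rewrite mulmxDr mulmx1 !mulmxA YD mul1mx mulmxBl mul1mx addrC subrK. Qed.

Lemma inflate_mul A B : inflate D Y A *m inflate D Y B = inflate D Y (A *m B).
Proof.
rewrite {1}/inflate mulmxDl mul1mx -!mulmxA inflate_row /inflate -addrA; congr (1%:M + _).
rewrite !mulmxA -mulmxDl -(mulmxA D (A - _)) -mulmxDr; congr (_ *m _ *m _).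
by rewrite mulmxBl mul1mx addrC addrA subrK.
Qed.

Lemma inflate_prod (I : Type) (r : seq I) (A : I -> 'M_n) :
  \prod_(i <- r) inflate D Y (A i) = inflate D Y (\prod_(i <- r) A i).
Proof.
elim: r => [|i r IHr]; last by rewrite !big_cons IHr; exact: inflate_mul.
by rewrite !big_nil /inflate subrr mulmx0 mul0mx addr0.
Qed.

Lemma det_inflate A : \det (inflate D Y A) = \det A.
Proof. by rewrite /inflate det_1D_mulC mulmxA YD mul1mx addrC subrK. Qed.

Lemma rank_inflateB1 A : \rank (inflate D Y A - 1%:M) = \rank (A - 1%:M).
Proof.
rewrite /inflate addrC addKr; apply/eqP; rewrite eqn_leq; apply/andP; split.
  exact: leq_trans (mxrankM_maxl _ _) (mxrankM_maxr _ _).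
have {1}-> : A - 1%:M = Y *m (D *m (A - 1%:M) *m Y) *m D.
  by rewrite !mulmxA YD mul1mx -mulmxA YD mulmx1.
exact: leq_trans (mxrankM_maxl _ _) (mxrankM_maxr _ _).
Qed.

Lemma inflate_unit A : A \in unitmx -> inflate D Y A \in unitmx.
Proof. by rewrite !unitmxE det_inflate. Qed.

End Theory.

Section Powers.
Variables (X : presentation) (F : local_system C X).

(** The recursion follows that of [dsum_pow], so that dimensions agree by computation. It assembles
    morphisms from [F] into one from a power of [F]. *)
Fixpoint stack n N : ('I_n -> 'M[C]_(rank F, N)) -> 'M[C]_(rank (dsum_pow F n), N) :=
  match n with
  | 0 => fun _ => 0
  | n'.+1 => fun phi => col_mx (phi ord0) (@stack n' N (fun i => phi (lift ord0 i)))
  end.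

(** Together with [diag_cols], the [Y] and [D] that present a power of [inflate x y a] as an
    inflation of the scalar [a] in size [n]. *)
Fixpoint diag_rows n (y : 'rV[C]_(rank F)) : 'M[C]_(n, rank (dsum_pow F n)) :=
  match n with
  | 0 => 0
  | n'.+1 => block_mx y 0 0 (diag_rows n' y) : 'M_(1 + n', rank F + _)
  end.

Fixpoint diag_cols n (x : 'cV[C]_(rank F)) : 'M[C]_(rank (dsum_pow F n), n) :=
  match n with
  | 0 => 0
  | n'.+1 => block_mx x 0 0 (diag_cols n' x) : 'M_(rank F + _, 1 + n')
  end.

Lemma rank_dsum_pow n : rank (dsum_pow F n) = (n * rank F)%N.
Proof. by elim: n => //= n ->; rewrite mulSn. Qed.

Lemma stack_intertwined n N (phi : 'I_n -> 'M[C]_(rank F, N)) g (A : 'M_N) :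
  (forall a, mon F g *m phi a = phi a *m A) ->
  mon (dsum_pow F n) g *m stack phi = stack phi *m A.
Proof.
elim: n phi => [|n IHn] phi fA; first by rewrite [LHS]flatmx0 [RHS]flatmx0.
rewrite -[LHS]/(block_mx (mon F g) 0 0 (mon (dsum_pow F n) g) *m
  col_mx (phi ord0) (stack (fun i => phi (lift ord0 i)))).
rewrite mul_block_col !mul0mx addr0 add0r fA IHn //.
exact/esym/mul_col_mx.
Qed.

Lemma diag_rows_stack n N (phi : 'I_n -> 'M[C]_(rank F, N)) y :
  diag_rows n y *m stack phi = \matrix_(a < n) (y *m phi a).
Proof.
elim: n phi => [|n IHn] phi; first by rewrite [LHS]flatmx0 [RHS]flatmx0.
rewrite -[LHS]/((block_mx y 0 0 (diag_rows n y) : 'M_(1 + n, rank F + _)) *m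
  col_mx (phi ord0) (stack (fun i => phi (lift ord0 i)))).
rewrite mul_block_col !mul0mx addr0 add0r IHn.
apply/row_matrixP => a; rewrite rowK.
case: (unliftP ord0 a) => [b|] ->.
  rewrite [X in row X _](_ : _ = rshift 1 b); last exact/val_inj.
  exact: etrans (rowKd _ _ _) (rowK _ _).
have E0 : (ord0 : 'I_n.+1) = lshift n (ord0 : 'I_1) by exact/val_inj.
rewrite {1}E0.
exact: etrans (rowKu _ _ _) (row_id _ _).
Qed.

Lemma diag_rows_cols n y x : y *m x = 1%:M -> diag_rows n y *m diag_cols n x = 1%:M.
Proof.
move=> yx; elim: n => [|n IHn]; first by rewrite [LHS]flatmx0 [RHS]flatmx0.
rewrite -[LHS]/((block_mx y 0 0 (diag_rows n y) : 'M_(1 + n, rank F + _)) *m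
  block_mx x 0 0 (diag_cols n x)).
rewrite mulmx_block !mulmx0 !mul0mx !addr0 add0r yx IHn.
exact: (esym (@scalar_mx_block C 1 n 1)).
Qed.

Lemma mon_dsum_pow_inflate n g x y a : mon F g = inflate x y a%:M ->
  mon (dsum_pow F n) g = inflate (diag_cols n x) (diag_rows n y) a%:M.
Proof.
move=> Fg; elim: n => [|n IHn]; first by rewrite [LHS]flatmx0 [RHS]flatmx0.
rewrite [LHS]/= Fg IHn /inflate -!raddfB /= !mul_mx_scalar -!scalemxAl.
rewrite [X in _ = _ + _ *: X](_ : _ = block_mx (x *m y) 0 0 (diag_cols n x *m diag_rows n y)).
  rewrite scale_block_mx !scaler0 [X in _ = X + _]scalar_mx_block add_block_mx !addr0.
  by [].
rewrite -[LHS]/((block_mx x 0 0 (diag_cols n x) : 'M_(rank F + _, 1 + n)) *m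
  block_mx y 0 0 (diag_rows n y)).
by rewrite mulmx_block !mulmx0 !mul0mx !addr0 add0r.
Qed.

Lemma mon_dsum_pow_scalar n g a : mon F g = a%:M -> mon (dsum_pow F n) g = a%:M.
Proof.
move=> Fg; elim: n => [|n IHn]; first by rewrite [LHS]flatmx0 [RHS]flatmx0.
by rewrite /= Fg IHn -scalar_mx_block.
Qed.

Lemma conjugate_dsum_pow n g s : conjugate (mon F g) (diag_of s) ->
  conjugate (mon (dsum_pow F n) g) (diag_of (flatten (nseq n s))).
Proof.
move=> Fs; elim: n => [|n IHn] /=; last exact: conjugate_diag_cat Fs IHn (perm_refl _).
exists 1%:M; rewrite row_free_unit row_full_unit unitmx1; split=> //.
by rewrite [LHS]flatmx0 [RHS]flatmx0.
Qed.

End Powers.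
End Inflation.

(** * Gluing a system on the disc section *)

Section Extension.
Variable C : fieldType.

Lemma commute_block m (a b : C) (Z : 'M[C]_(1 + m)) : a != b ->
  Z *m block_mx a%:M 0 0 b%:M = block_mx a%:M 0 0 b%:M *m Z ->
  Z = block_mx (ulsubmx Z) 0 0 (drsubmx Z).
Proof.
move=> ab; rewrite -{1 2}[Z]submxK !mulmx_block !mulmx0 !mul0mx !addr0 !add0r.
rewrite !mul_mx_scalar !mul_scalar_mx => /eq_block_mx[_ Eu Ed _].
rewrite -[LHS]submxK; congr block_mx; apply/eqP.
  have /eqP := Eu; rewrite -subr_eq0 -scalerBl scaler_eq0 subr_eq0 eq_sym (negPf ab).
  by [].
by have /eqP := Ed; rewrite -subr_eq0 -scalerBl scaler_eq0 subr_eq0 (negPf ab).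
Qed.

Lemma stable_prod (I : Type) (r : seq I) d k (A : I -> 'M[C]_d) (U : 'M[C]_(k, d)) :
  (forall i, stablemx U (A i)) -> stablemx U (\prod_(i <- r) A i).
Proof.
move=> stU; elim: r => [|i r IHr]; first by rewrite big_nil [U *m _]mulmx1.
rewrite big_cons; have -> : U *m (A i * \prod_(j <- r) A j) = U *m A i *m \prod_(j <- r) A j.
  exact: mulmxA.
exact: submx_trans (submxMr _ (stU i)) IHr.
Qed.

Variables (m : nat) (L1 : local_system C turbine_shaft_bullet).
Variables (D0 : 'M[C]_(rank L1, 1 + m)) (Y0 : 'M[C]_(1 + m, rank L1)).
Variables (lam : 'I_m.+1 -> C) (eta1 eta2 eps : C) (A0 : 'I_m.+1 -> 'M[C]_(1 + m)).
Local Notation Delta0 := (block_mx eta2%:M 0 0 eta1%:M : 'M[C]_(1 + m)).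
Hypotheses (YD : Y0 *m D0 = 1%:M) (eps0 : eps != 0).
Hypotheses (L1a : mon L1 (Alpha ord0) = inflate D0 Y0 Delta0).
Hypotheses (L1d : mon L1 (Delta 1) = eps%:M).
Variables (p q : {poly C}).
Hypotheses (pq : coprimep p q) (L1p : evm (mon L1 (Omega0 1)) p = 0).
Hypotheses (L1q : evm (mon L1 (OmegaInf 1)) q = 0).
Hypotheses (eta1_1 : eta1 != 1) (eta2_1 : eta2 != 1) (eta12 : eta1 != eta2).
Hypotheses (lam0 : forall i, lam i != 0) (dA0 : forall i, \det (A0 i) = lam i).
Hypotheses (pA0 : \prod_(i <- enum 'I_m.+1) A0 i = Delta0) (iA0 : row_irreducible A0).

Lemma mon_bullet (L : local_system C turbine_shaft_bullet) :
  mon L (Alpha ord0) *m mon L (OmegaInf 1) = mon L (Omega0 1).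
Proof.
by rewrite -mon_shaft enum_ordSl enum_ord0 big_cons big_nil [_ * _]mulmx1.
Qed.

(** Inflation is multiplicative, so the product of the glued reflections is the inflated [Delta0],
    which is [alpha_bullet] on [L1]. *)
Let ext_rep : is_representation (X := turbine_shaft m.+1)
  (turbine_mon (fun i => inflate D0 Y0 (A0 i)) (mon L1 (Omega0 1)) (mon L1 (OmegaInf 1)) eps).
Proof.
have [uL1 _] := monP L1; apply: turbine_shaft_rep => //.
  by move=> i; rewrite inflate_unit // unitmxE dA0 unitfE.
by rewrite inflate_prod // pA0 -L1a mon_bullet.
Qed.

Definition extension_system : local_system C (turbine_shaft m.+1) := LocalSystem ext_rep.
Local Notation L := extension_system.

Lemma extension_restriction : isomorphic (restriction (bullet_map C m.+1) L) L1.
Proof.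
exists 1%:M; rewrite row_free_unit row_full_unit unitmx1; split=> // -[i|||] /=;
  rewrite ?mulmx1 ?mul1mx ?expr1 //.
by rewrite eval_word_alpha_prod inflate_prod // pA0 ord1 L1a.
Qed.

(** On columns the quotient map is [Y0] followed by the isomorphism [Z]; every glued reflection is
    the identity on the kernel of [Y0]. *)
Lemma extension_quotient (Lt : local_system C (disc_section m.+1))
    (Z : 'M[C]_(rank Lt, 1 + m)) :
  row_free Z -> row_full Z -> (forall i, mon Lt i *m Z = Z *m A0 i) ->
  exists2 K : 'M[C]_(rank (restriction (disc_map C m.+1) L)),
    constant_subsystem K & quotient_iso K Lt.
Proof.
move=> fZ uZ ZE; exists (kermx Y0^T) => [i|].
  apply/sub_fixed; rewrite [mon (restriction _ _) _]eval_word1.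
  have YK : Y0 *m (kermx Y0^T)^T = 0.
    by apply: trmx_inj; rewrite trmx_mul trmxK mulmx_ker trmx0.
  by rewrite /inflate mulmxDl mul1mx -[_ *m Y0 *m _]mulmxA YK mulmx0 addr0.
exists (Z *m Y0); split.
- by move=> i; rewrite [mon (restriction _ _) _]eval_word1 -mulmxA inflate_row // !mulmxA ZE.
- by rewrite /row_free mxrankMfree //; apply/row_freeP; exists D0.
have [Z' [_ Z'Z]] := invertible_ex fZ uZ.
apply/eqmxP; apply/andP; rewrite trmx_mul; split; apply/sub_kermxP; last first.
  by rewrite mulmxA mulmx_ker mul0mx.
by rewrite -[LHS]mulmx1 -trmx1 -Z'Z trmx_mul mulmxA -[kermx _ *m _ *m _]mulmxA mulmx_ker mul0mx.
Qed.

(** The set [T] of rows [t] with [t Y0] in [U] is stable under the irreducible disc system. If [T]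
    is everything, [Omega0] and [OmegaInf] agree modulo [U]; if it is zero, they agree on [U]. *)
Lemma extension_irreducible : irreducible L.
Proof.
apply: irreducible_rows => [|n U stU].
  rewrite lt0n; apply/eqP => N0; have := congr1 (fun M => \rank M) YD.
  rewrite mxrank1 => rY; have := leq_trans (mxrankM_maxl Y0 D0) (rank_leq_col _).
  by rewrite rY N0.
pose T := kermx (Y0 *m cokermx U).
have TP k (t : 'M_(k, 1 + m)) : (t <= T)%MS = (t *m Y0 <= U)%MS.
  by rewrite [RHS]submxE -mulmxA; apply/sub_kermxP/eqP.
have stT i : stablemx T (A0 i).
  rewrite TP -mulmxA -(inflate_row YD) mulmxA; apply: submx_trans (stU (Alpha i)).
  by rewrite submxMr // -TP.
have st0 := stU (Omega0 _); have sti := stU (OmegaInf _).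
have aE : mon L1 (Omega0 1) - mon L1 (OmegaInf 1) =
    D0 *m (Delta0 - 1%:M) *m Y0 *m mon L1 (OmegaInf 1).
  by rewrite -mon_bullet L1a mulmxDl mul1mx addrC addKr.
have [T0|Tf] := iA0 stT; [left | right]; last first.
  apply: (no_common_quotient pq L1p L1q st0).
  rewrite aE (submx_trans _ sti) // submxMr // (submx_trans (submxMl _ _)) //.
  by rewrite -[Y0]mul1mx -TP submx_full.
apply: (no_common_sub pq L1p L1q st0); apply/eqP; rewrite -subr_eq0 -mulmxBr aE.
suff : (U *m D0 *m (Delta0 - 1%:M) <= T)%MS.
  by rewrite T0 submx0 => /eqP E; rewrite !mulmxA E !mul0mx.
rewrite TP; have [uL1 _] := monP L1; have uI := uL1 (OmegaInf 1).
have fI : row_free (mon L1 (OmegaInf 1)) by rewrite row_free_unit.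
have -> : U *m D0 *m (Delta0 - 1%:M) *m Y0 = U *m mon L1 (Alpha ord0) - U.
  by rewrite L1a /inflate [U *m (_ + _)]mulmxDr mulmx1 addrAC subrr add0r !mulmxA.
rewrite addmx_sub ?eqmx_opp // L1a -pA0 -inflate_prod //.
by apply: stable_prod => i; exact: stU (Alpha i).
Qed.


(* The last clause says that the automorphisms of [G (+) F^m] in [GL_1 x GL_m] act on the
   intertwiner as they act on the row space of [Y0 P]. *)
Definition liftable N (A B : 'M[C]_N) := exists P : 'M[C]_(rank L1, N),
  [/\ mon L1 (Omega0 1) *m P = P *m A, mon L1 (OmegaInf 1) *m P = P *m B,
      row_free (Y0 *m P) & forall (z : 'M_1) (Z : 'M_m), exists P' : 'M[C]_(rank L1, N),
      [/\ mon L1 (Omega0 1) *m P' = P' *m A, mon L1 (OmegaInf 1) *m P' = P' *m B &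
          Y0 *m P' = block_mx z 0 0 Z *m (Y0 *m P)]].

Hypothesis uA0 : forall A : 'I_m.+1 -> 'M[C]_(1 + m),
  (forall i, (\rank (A i - 1%:M)%R <= 1)%N) -> (forall i, \det (A i) = lam i) ->
  (\rank (\prod_(i <- enum 'I_m.+1) A i - eta1%:M)%R <= 1)%N ->
  exists2 Z : 'M[C]_(1 + m), Z \in unitmx & forall i, Z *m A i = A0 i *m Z.

Lemma extension_unique (M : local_system C (turbine_shaft m.+1)) :
  rank M = rank L1 -> mon M (Delta _) = eps%:M ->
  (forall i, (\rank (mon M (Alpha i) - 1%:M)%R <= 1)%N) ->
  (forall i, \det (mon M (Alpha i)) = lam i) ->
  evm (mon M (Omega0 _)) p = 0 -> evm (mon M (OmegaInf _)) q = 0 ->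
  liftable (mon M (Omega0 _)) (mon M (OmegaInf _)) -> isomorphic L M.
Proof.
move=> rM Md rMa dMa Mp Mq [P [P0 Pi fY lift]].
have [uM _] := monP M; have [uL1 _] := monP L1.
set A := mon M (Omega0 _) in P0 Mp lift *; set B := mon M (OmegaInf _) in Pi Mq lift *.
set T := \prod_(i <- enum 'I_m.+1) mon M (Alpha i).
have TB : T *m B = A by exact: mon_shaft.
have alphaE (Q : 'M_(rank L1, rank M)) : mon L1 (Omega0 1) *m Q = Q *m A ->
    mon L1 (OmegaInf 1) *m Q = Q *m B -> mon L1 (Alpha ord0) *m Q = Q *m T.
  move=> Q0 Qi; apply: (can_inj (mulmxK (uM (OmegaInf _)))).
  by rewrite -/B -!mulmxA TB -Q0 -Qi mulmxA mon_bullet.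
have YT Q : mon L1 (Omega0 1) *m Q = Q *m A -> mon L1 (OmegaInf 1) *m Q = Q *m B ->
    Y0 *m Q *m T = Delta0 *m (Y0 *m Q).
  by move=> Q0 Qi; rewrite -mulmxA -alphaE // L1a mulmxA inflate_row // mulmxA.
set Y := Y0 *m P in fY lift.
have YTY : Y *m T = Delta0 *m Y by exact: YT.
have uD : Delta0 - 1%:M \in unitmx.
  rewrite scalar_mx_block opp_block_mx add_block_mx !oppr0 !addr0 -!raddfB.
  by rewrite block_diag_mx_unit !unitmxE !det_scalar !unitrX ?unitfE ?subr_eq0.
have YT1 : (Y <= T - 1%:M)%MS.
  rewrite -[Y](mulKmx uD) mulmxBl mul1mx -YTY -{2}[Y]mulmx1 -mulmxBr mulmxA.
  exact: submxMl.
have /fin_all_exists[uf ufE] i : exists uf : 'cV[C]_(rank M) * 'rV[C]_(rank M),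
    mon M (Alpha i) = 1%:M + uf.1 *m uf.2.
  have [u [f E]] := rank_le1 (rMa i).
  by exists (u, f); rewrite -E addrC subrK.
pose F := \matrix_i (uf i).2.
have fF i : ((uf i).2 <= F)%MS by rewrite -[(uf i).2](rowK (fun i => (uf i).2)) row_sub.
have TF : (T - 1%:M <= F)%MS.
  apply: prod_sub1_rows => i; rewrite ufE addrC addKr.
  exact: submx_trans (submxMl _ _) (fF i).
have rY : \rank Y = m.+1 by apply/eqP: fY.
(* [Y] lies in the row space of [T - 1], which lies in that of the [m + 1] rows of [F]; as [Y] has
   rank [m + 1], all three coincide. *)
have FY : (F <= Y)%MS.
  rewrite -(mxrank_leqif_sup (submx_trans YT1 TF)) eqn_leq mxrankS ?(submx_trans YT1) //=.
  by rewrite rY rank_leq_row.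
have /fin_all_exists[t tE] i : exists t : 'rV_(1 + m), (uf i).2 = t *m Y.
  by apply/submxP/(submx_trans (fF i)).
(* The action of the reflections on the rows of [Y]: a second solution of the disc problem, to be
   matched with [A0]. *)
pose a i : 'M[C]_(1 + m) := 1%:M + (Y *m (uf i).1) *m t i.
have Ya i : Y *m mon M (Alpha i) = a i *m Y.
  by rewrite ufE mulmxDr mulmx1 mulmxDl mul1mx tE !mulmxA.
have pa : \prod_(i <- enum 'I_m.+1) a i = Delta0.
  apply: (row_free_inj fY); rewrite -YTY /T.
  by rewrite (prod_mxE _ (fun i => esym (Ya i))).
have [|||Z uZ ZE] := @uA0 a.
- by move=> i; rewrite /a addrC addKr mxrank_outer.
- by move=> i; rewrite -dMa ufE !det_1D_outer tE mulmxA.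
- rewrite pa scalar_mx_block opp_block_mx add_block_mx !oppr0 !addr0 subrr.
  by rewrite rank_diag_block_mx mxrank0 addn0 rank_leq_row.
(* Both solutions have product [Delta0], so [Z] commutes with it, is block diagonal, and lifts: [P]
   is replaced by [P'], on which the reflections act by [A0]. *)
have ZD : Z *m Delta0 = Delta0 *m Z.
  rewrite -{1}pa -pA0; apply/esym; exact: (prod_mxE _ (fun i => esym (ZE i))).
have eta21 : eta2 != eta1 by rewrite eq_sym.
have [P' [P'0 P'i]] := lift (ulsubmx Z) (drsubmx Z).
rewrite -(commute_block eta21 ZD) => Y'E; set Y' := Y0 *m P' in Y'E.
have Y'a i : Y' *m mon M (Alpha i) = A0 i *m Y' by rewrite Y'E -mulmxA Ya !mulmxA ZE.
have Y'T : Y' *m T = Delta0 *m Y' by exact: YT.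
(* The row space of [P'] contains the image of [A - B], so the quotient by it is a common quotient
   and vanishes. *)
have uP' : row_full P'.
  apply: (no_common_quotient pq Mp Mq); first by rewrite -P'0 submxMl.
  have -> : A - B = (T - 1%:M) *m B by rewrite mulmxBl mul1mx TB.
  apply: submx_trans (_ : (P' *m B <= P')%MS); last by rewrite -P'i submxMl.
  apply: submxMr; apply: submx_trans TF (submx_trans FY _).
  by rewrite -[Y](mulKmx uZ) -Y'E mulmxA submxMl.
have fP' : row_free P' by apply: square_full_free.
(* The dual count with the columns of the reflections: [ker (T - 1)] equals [ker X], so every
   reflection is trivial on it. *)
pose X := \matrix_(j, i) (uf i).1 j 0.
have [E TX] : exists E, T - 1%:M = X *m E.
  apply: prod_sub1_cols => i; exists (delta_mx i 0 *m (uf i).2).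
  rewrite ufE addrC addKr mulmxA -colE; congr (_ *m _); apply/colP => j.
  by rewrite !mxE.
have KX : (kermx (T - 1%:M) <= kermx X)%MS.
  have XK : (kermx X <= kermx (T - 1%:M))%MS.
    by apply/sub_kermxP; rewrite TX mulmxA mulmx_ker mul0mx.
  rewrite -(mxrank_leqif_sup XK) eqn_leq mxrankS //= !mxrank_ker leq_sub2l //.
  by rewrite (leq_trans (rank_leq_col X)) // -[X in (X <= _)%N]rY mxrankS.
(* [D0 Y'] is the part of [P'] along the image of [alpha - 1]; the remainder lands in [ker (T - 1)],
   where the reflections are trivial. *)
have RK : ((P' - D0 *m Y') *m (T - 1%:M)) = 0.
  have e1 : P' *m (T - 1%:M) = D0 *m (Delta0 - 1%:M) *m Y'.
    by rewrite mulmxBr mulmx1 -alphaE // L1a /inflate mulmxDl mul1mx addrAC subrr add0r -mulmxA.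
  have e2 : D0 *m Y' *m (T - 1%:M) = D0 *m (Delta0 - 1%:M) *m Y'.
    by rewrite -[LHS]mulmxA mulmxBr mulmx1 Y'T -[RHS]mulmxA mulmxBl mul1mx.
  by rewrite mulmxBl e1 e2 subrr.
have Ra i : P' *m mon M (Alpha i) = inflate D0 Y0 (A0 i) *m P'.
  have Ru : (P' - D0 *m Y') *m (uf i).1 = 0.
    have /sub_kermxP RX : ((P' - D0 *m Y') <= kermx X)%MS.
      by apply: submx_trans KX; apply/sub_kermxP.
    have -> : (uf i).1 = X *m delta_mx i 0 by rewrite -colE; apply/colP => j; rewrite !mxE.
    by rewrite mulmxA RX mul0mx.
  have : (P' - D0 *m Y') *m (mon M (Alpha i) - 1%:M) = 0.
    by rewrite ufE [1%:M + _]addrC addrK mulmxA Ru mul0mx.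
  move/eqP; rewrite mulmxBl subr_eq0 mulmxBr mulmx1 subr_eq => /eqP ->.
  by rewrite -(mulmxA D0) mulmxBr mulmx1 Y'a mulmxDl mul1mx addrC -!mulmxA mulmxBl mul1mx.
exists P'; split=> // -[i|||] /=; rewrite ?Ra ?Md ?scalar_mxC //.
Qed.
End Extension.

(** * The systems F and G, and the extension *)

(** [X^k - a] is separable: its derivative can vanish only at 0, which is not a root. *)
Lemma roots_of_unity_seq (C : numClosedFieldType) k (a : C) : (0 < k)%N -> a != 0 ->
  exists s : seq C, [/\ size s = k, uniq s & poly_of s = 'X^k - a%:P].
Proof.
move=> k0 a0; have [s sE] := closed_field_poly_normal ('X^k - a%:P).
move: sE; rewrite lead_coefXnsubC // scale1r => sE; exists s; split=> //.
  by apply: succn_inj; rewrite -(size_prod_XsubC s id) -sE size_XnsubC.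
rewrite -separable_prod_XsubC -sE unlock derivB derivXn derivC subr0 -scaler_nat.
rewrite coprimepZr ?pnatr_eq0 -?lt0n // coprimep_expr // coprimepX.
by rewrite rootE !hornerE expr0n gtn_eqF // sub0r oppr_eq0.
Qed.

(** * Companion pairs with prescribed spectra *)

Section Hyper.
Variable C : fieldType.

Lemma prod_poly_of (s : seq C) : (poly_of s).[0] = (-1) ^+ size s * \prod_(x <- s) x.
Proof.
rewrite /poly_of horner_prod; elim: s => [|x s IHs]; first by rewrite !big_nil expr0 mul1r.
by rewrite !big_cons IHs hornerXsubC /= exprS; ring.
Qed.

Variables (d : nat) (s0 s1 : seq C).
Hypotheses (d0 : (0 < d)%N) (sz0 : size s0 = d) (sz1 : size s1 = d).
Hypotheses (us0 : uniq s0) (us1 : uniq s1) (n0 : 0 \notin s0) (n1 : 0 \notin s1).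
Hypothesis (s01 : forall x, x \in s1 -> x \notin s0).

Definition model0 : 'M[C]_d := companion d (poly_of s0).
Definition model1 : 'M[C]_d := companion d (poly_of s1).

Lemma conjugate_unit e (A : 'M[C]_e) s : conjugate A (diag_of s) -> 0 \notin s -> A \in unitmx.
Proof.
move=> cA s0'; rewrite unitmxE (conjugate_det cA) unitfE prodf_seq_neq0.
by apply/allP => x xs /=; apply: contraNneq s0' => <-.
Qed.

Lemma conj_model0 : conjugate model0 (diag_of s0).
Proof. exact: conjugate_companion. Qed.

Lemma conj_model1 : conjugate model1 (diag_of s1).
Proof. exact: conjugate_companion. Qed.

Lemma model0_unit : model0 \in unitmx.
Proof. exact: conjugate_unit conj_model0 n0. Qed.

Lemma model1_unit : model1 \in unitmx.
Proof. exact: conjugate_unit conj_model1 n1. Qed.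

Lemma evm_poly_of e (A : 'M[C]_e) s t : conjugate A (diag_of s) -> {subset s <= t} ->
  evm A (poly_of t) = 0.
Proof.
move=> cA st; apply: (conjugate_evm0 cA); apply/allP => x xs.
by rewrite root_prod_XsubC st.
Qed.

Lemma poly_of_coprime : coprimep (poly_of s0) (poly_of s1).
Proof. by apply: coprime_poly_of => x /s01; rewrite root_prod_XsubC. Qed.

Lemma model_irreducible : row_irreducible (pair_of model0 model1).
Proof.
apply: hypergeometric_irreducible poly_of_coprime _ _ (rank_companionB _ _ _).
  exact: evm_poly_of conj_model0 _.
exact: evm_poly_of conj_model1 _.
Qed.

(** The companion matrices differ by rank one, and the quotient of their determinants is the special
    eigenvalue [eta]; dividing [x] by [eta - 1] gives [y x = 1]. *)
Lemma model_inflate eta : eta = (\prod_(x <- s0) x) / (\prod_(x <- s1) x) -> eta != 1 ->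
  exists (x : 'cV_d) (y : 'rV_d), y *m x = 1%:M /\
    model0 *m invmx model1 = inflate x y eta%:M.
Proof.
move=> etaE eta1; have u1 := model1_unit.
have : (\rank (model0 *m invmx model1 - 1%:M)%R <= 1)%N.
  rewrite -(mulmxV u1) -mulmxBl.
  exact: leq_trans (mxrankM_maxl _ _) (rank_companionB _ _ _).
case/rank_le1=> x [y xy].
have E : model0 *m invmx model1 = 1%:M + x *m y by rewrite -xy addrC subrK.
have yx : (y *m x) 0 0 = eta - 1.
  apply: (addrI 1); rewrite -det_1D_outer -E det_mulmx det_inv [RHS]addrC subrK etaE.
  by rewrite (conjugate_det conj_model0) (conjugate_det conj_model1).
have e1 : eta - 1 != 0 by rewrite subr_eq0.
exists ((eta - 1)^-1 *: x), y; split.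
  by rewrite -scalemxAr [y *m x]mx11_scalar yx scale_scalar_mx mulVf.
by rewrite E /inflate -raddfB mul_mx_scalar scalerA divff // scale1r.
Qed.

Lemma model_embedding N c (A B : 'M[C]_N) :
  evm A (poly_of s0) = 0 -> evm B (poly_of s1) = 0 -> (\rank (A - B)%R <= c)%N ->
  (d.-1 * c < N)%N -> exists2 phi : 'M[C]_(d, N), row_free phi &
    model0 *m phi = phi *m A /\ model1 *m phi = phi *m B.
Proof.
move=> Ap Bq rAB cN.
have [||phi phi0 [phiA phiB]] :=
  hypergeometric_embedding d0 (monic_prod_XsubC s0 xpredT id) (monic_prod_XsubC s1 xpredT id)
   _ _ Ap Bq rAB cN; rewrite ?size_prod_XsubC ?sz0 ?sz1 //.
exists phi => //.
by apply: row_irreducible_free (pair_of A B) _ model_irreducible _ phi0; case.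
Qed.

End Hyper.

(** * The systems F and G and their local data *)

Section Systems.
Variable C : fieldType.

Lemma with_mult1 p (x : 'I_p -> C) : with_mult x (fun=> 1%N) = [seq x i | i <- enum 'I_p].
Proof. by rewrite /with_mult; elim: (enum _) => //= i s ->. Qed.

Lemma mem_with_mult p (x : 'I_p -> C) mu y : y \in with_mult x mu -> exists i, y = x i.
Proof.
by case/flattenP=> s /mapP[i _ ->]; rewrite mem_nseq => /andP[_ /eqP->]; exists i.
Qed.

Lemma count_with_mult p (x : 'I_p -> C) mu (a : pred C) :
  count a (with_mult x mu) = (\sum_i a (x i) * mu i)%N.
Proof.
rewrite /with_mult count_flatten -map_comp sumnE big_map big_enum.
by apply: eq_bigr => i _; rewrite /= count_nseq.
Qed.

Lemma size_with_mult p (x : 'I_p -> C) mu : size (with_mult x mu) = (\sum_i mu i)%N.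
Proof. by rewrite -count_predT count_with_mult; apply: eq_bigr => i _; rewrite mul1n. Qed.

Variables (k m : nat) (r : int) (eps b : C) (zs : seq C) (xi : 'I_k.+1 -> C) (eta1 eta2 : C).
Local Notation wid := (widen_ord (leqnSn k)).
Local Notation e := (eps ^ r).
Hypotheses (k0 : (0 < k)%N) (eps0 : eps != 0) (b0 : b != 0) (xi0 : forall j, xi j != 0).
Hypotheses (szs : size zs = k) (uzs : uniq zs) (zsE : poly_of zs = 'X^k - e%:P).
Hypotheses (xi_inj : injective xi) (xib : forall j, xi j != b).
Hypotheses (xik : forall j, xi j ^+ k != e) (bk : b ^+ k != e).
Hypothesis eta1E : eta1 = (-1) ^+ k.-1 * e * \prod_(i < k) (xi (wid i))^-1.
Hypothesis eta2E : eta2 = (-1) ^+ k.-1 * e * b * \prod_(i < k.+1) (xi i)^-1.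
Hypotheses (eta1_1 : eta1 != 1) (eta2_1 : eta2 != 1) (eta12 : eta1 != eta2).

Definition xF := [seq xi (wid i) | i <- enum 'I_k].
Definition xG := [seq xi i | i <- enum 'I_k.+1].
Local Notation zG := (rcons zs b).

Let e0 : e != 0. Proof. by rewrite expfz_neq0. Qed.

Lemma mem_zs x : (x \in zs) = (x ^+ k == e).
Proof. by rewrite -root_prod_XsubC -/(poly_of zs) zsE rootE !hornerE subr_eq0. Qed.

Lemma zs_neq0 : 0 \notin zs.
Proof. by rewrite mem_zs expr0n gtn_eqF // eq_sym. Qed.

Lemma b_zs : b \notin zs. Proof. by rewrite mem_zs. Qed.

Lemma uniq_zG : uniq zG. Proof. by rewrite rcons_uniq b_zs. Qed.

Lemma zG_neq0 : 0 \notin zG. Proof. by rewrite mem_rcons inE negb_or eq_sym b0 zs_neq0. Qed.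

Lemma xF_props : [/\ size xF = k, uniq xF, 0 \notin xF & forall x, x \in xF -> x \notin zs].
Proof.
split; first by rewrite size_map size_enum_ord.
- by rewrite map_inj_uniq ?enum_uniq // => i j /xi_inj/(congr1 val) /= ij; exact: val_inj.
- by apply/mapP => -[i _ /eqP]; rewrite eq_sym (negPf (xi0 _)).
by move=> x /mapP[i _ ->]; rewrite mem_zs.
Qed.

Lemma xG_props : [/\ size xG = k.+1, uniq xG, 0 \notin xG & forall x, x \in xG -> x \notin zG].
Proof.
split; first by rewrite size_map size_enum_ord.
- by rewrite map_inj_uniq ?enum_uniq.
- by apply/mapP => -[i _ /eqP]; rewrite eq_sym (negPf (xi0 _)).
by move=> x /mapP[i _ ->]; rewrite mem_rcons inE negb_or xib mem_zs xik.
Qed.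

Lemma prod_zs : \prod_(x <- zs) x = (-1) ^+ k.-1 * e.
Proof.
have := prod_poly_of zs; rewrite zsE szs !hornerE expr0n gtn_eqF //= sub0r.
have -> : (-1) ^+ k = - (-1) ^+ k.-1 :> C by rewrite -{1}(prednK k0) exprS mulN1r.
rewrite mulNr => /oppr_inj ->.
by rewrite mulrA -expr2 sqrr_sign mul1r.
Qed.

(** The prefactor [(-1)^(k-1) eps^r] is the product of the [k]-th roots of [eps^r], so [eta1] is
    [det Omega0 / det OmegaInf] on [F]. *)
Lemma eta1_det : eta1 = (\prod_(x <- zs) x) / (\prod_(x <- xF) x).
Proof. by rewrite prod_zs eta1E big_map big_enum /= prodfV. Qed.

Lemma eta2_det : eta2 = (\prod_(x <- zG) x) / (\prod_(x <- xG) x).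
Proof. by rewrite -cats1 big_cat big_seq1 /= prod_zs eta2E big_map big_enum /= prodfV. Qed.

Definition F0 : 'M[C]_k := model0 k zs.
Definition F1 : 'M[C]_k := model1 k xF.
Definition G0 : 'M[C]_k.+1 := model0 k.+1 zG.
Definition G1 : 'M[C]_k.+1 := model1 k.+1 xG.

Lemma pow_of_evm n (A : 'M[C]_n) : evm A (poly_of zs) = A ^+ k - e%:M.
Proof. by rewrite zsE evm_XnsubC. Qed.

Lemma pair_rep n (A B : 'M[C]_n) : A \in unitmx -> B \in unitmx ->
  is_representation (X := turbine_shaft 1) (turbine_mon (fun=> A *m invmx B) A B eps).
Proof.
move=> uA uB; apply: turbine_shaft_rep => //.
  by move=> _; rewrite unitmx_mul uA unitmx_inv.
rewrite enum_ordSl enum_ord0 big_cons big_nil.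
by rewrite -[X in X *m _]/(_ *m 1%:M) mulmx1 mulmxKV.
Qed.

Lemma F_rep :
  is_representation (X := turbine k r 1) (turbine_mon (fun=> F0 *m invmx F1) F0 F1 eps).
Proof.
have [sF uF nF dF] := xF_props.
have u0 := model0_unit szs uzs zs_neq0; have u1 := model1_unit sF uF nF.
have [uT relT] := pair_rep u0 u1; split=> // _ _ [u v|]; first exact: relT.
rewrite /= !mulmx1 mxpowz_scalar; apply/eqP; rewrite -subr_eq0 -pow_of_evm; apply/eqP.
exact: evm_poly_of (conj_model0 szs uzs) _.
Qed.

Lemma G_rep :
  is_representation (X := turbine_shaft 1) (turbine_mon (fun=> G0 *m invmx G1) G0 G1 eps).
Proof.
have [sG uG nG dG] := xG_props; apply: pair_rep.
  by apply: model0_unit uniq_zG zG_neq0; rewrite size_rcons szs.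
exact: model1_unit.
Qed.

Definition Fs : local_system C (turbine k r 1) := LocalSystem F_rep.
Definition Gs : local_system C turbine_shaft_bullet := LocalSystem G_rep.

Lemma mon_bullet_bare (L : local_system C (turbine k r 1)) :
  mon L (Alpha ord0) *m mon L (OmegaInf 1) = mon L (Omega0 1).
Proof.
by rewrite -mon_bare enum_ordSl enum_ord0 big_cons big_nil [_ * _]mulmx1.
Qed.

Lemma rank_omegaB n (A B T : 'M[C]_n) c : T *m B = A -> (\rank (T - 1%:M)%R <= c)%N ->
  (\rank (A - B)%R <= c)%N.
Proof.
move=> <-; rewrite -{2}[B]mul1mx -mulmxBl.
exact: leq_trans (mxrankM_maxl _ _).
Qed.

(** The dimension count gives a nonzero map from the companion model, injective by irreducibility
    and bijective by rank. The polynomial killing [Omega0] comes from [omega_0^k = delta^r]. *)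
Lemma F_unique (M : local_system C (turbine k r 1)) :
  rank M = k -> mon M (Delta 1) = eps%:M -> evm (mon M (OmegaInf 1)) (poly_of xF) = 0 ->
  (\rank (mon M (Alpha ord0) - 1%:M)%R <= 1)%N -> isomorphic M Fs.
Proof.
move=> rM Md Mi Ma; have [sF uF nF dF] := xF_props; have [uM _] := monP M.
have M0 : evm (mon M (Omega0 1)) (poly_of zs) = 0.
  by rewrite pow_of_evm (mon_bare_pow Md) subrr.
have rM01 := rank_omegaB (mon_bullet_bare M) Ma.
have [|P fP [P0 Pi]] := model_embedding k0 szs sF uzs uF dF M0 Mi rM01.
  by rewrite muln1 rM prednK.
have uP : row_full P by apply/eqP; rewrite (eqP fP) rM.
apply: isomorphic_sym; exists P; split=> // -[i|||] /=; rewrite ?P0 ?Pi ?Md ?scalar_mxC //.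
apply: (can_inj (mulmxK (uM (OmegaInf 1)))); rewrite ord1.
have u1 : F1 \in unitmx by exact: model1_unit.
by rewrite -[RHS]mulmxA mon_bullet_bare -P0 -[LHS]mulmxA -Pi mulmxA mulmxKV.
Qed.

Lemma G_unique (M : local_system C turbine_shaft_bullet) :
  rank M = k.+1 -> mon M (Delta 1) = eps%:M -> evm (mon M (Omega0 1)) (poly_of zG) = 0 ->
  evm (mon M (OmegaInf 1)) (poly_of xG) = 0 ->
  (\rank (mon M (Alpha ord0) - 1%:M)%R <= 1)%N -> isomorphic M Gs.
Proof.
move=> rM Md M0 Mi Ma; have [sG uG nG dG] := xG_props; have [uM _] := monP M.
have sz : size zG = k.+1 by rewrite size_rcons szs.
have rM01 := rank_omegaB (mon_bullet M) Ma.
have [|P fP [P0 Pi]] := model_embedding (ltn0Sn k) sz sG uniq_zG uG dG M0 Mi rM01.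
  by rewrite muln1 rM.
have uP : row_full P by apply/eqP; rewrite (eqP fP) rM.
apply: isomorphic_sym; exists P; split=> // -[i|||] /=; rewrite ?P0 ?Pi ?Md ?scalar_mxC //.
apply: (can_inj (mulmxK (uM (OmegaInf 1)))); rewrite ord1.
have u1 : G1 \in unitmx by exact: model1_unit.
by rewrite -[RHS]mulmxA mon_bullet -P0 -[LHS]mulmxA -Pi mulmxA mulmxKV.
Qed.


Lemma F_conj0 : conjugate (mon Fs (Omega0 1)) (diag_of zs).
Proof. exact: conj_model0. Qed.

Lemma F_conj1 : conjugate (mon Fs (OmegaInf 1)) (diag_of xF).
Proof. by have [sF uF _ _] := xF_props; exact: conj_model1. Qed.

Lemma G_conj0 : conjugate (mon Gs (Omega0 1)) (diag_of zG).
Proof. by apply: conj_model0 uniq_zG; rewrite size_rcons szs. Qed.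

Lemma G_conj1 : conjugate (mon Gs (OmegaInf 1)) (diag_of xG).
Proof. by have [sG uG _ _] := xG_props; exact: conj_model1. Qed.

Lemma F_inflate : exists (x : 'cV_k) (y : 'rV_k), y *m x = 1%:M /\
  mon Fs (Alpha ord0) = inflate x y eta1%:M.
Proof.
by have [sF uF nF _] := xF_props; apply: model_inflate => //; exact: eta1_det.
Qed.

Lemma G_inflate : exists (x : 'cV_k.+1) (y : 'rV_k.+1), y *m x = 1%:M /\
  mon Gs (Alpha ord0) = inflate x y eta2%:M.
Proof.
have [sG uG nG _] := xG_props; apply: model_inflate => //; last exact: eta2_det.
- by rewrite size_rcons szs.
- exact: uniq_zG.
Qed.

Lemma prod_neq0 (s : seq C) : 0 \notin s -> \prod_(x <- s) x != 0.
Proof.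
by move=> s0; rewrite prodf_seq_neq0; apply/allP => x xs /=; apply: contraNneq s0 => <-.
Qed.

Lemma eta1_neq0 : eta1 != 0.
Proof.
have [_ _ nF _] := xF_props.
by rewrite eta1_det mulf_neq0 ?invr_eq0 // ?prod_neq0 // zs_neq0.
Qed.

Lemma eta2_neq0 : eta2 != 0.
Proof.
have [_ _ nG _] := xG_props.
by rewrite eta2_det mulf_neq0 ?invr_eq0 // ?prod_neq0 // zG_neq0.
Qed.

Lemma rank_scalarB1 n (a : C) : a != 1 -> \rank (a%:M - 1%:M : 'M_n) = n.
Proof. by move=> a1; rewrite -raddfB /= -scalemx1 mxrank_scale_nz ?mxrank1 ?subr_eq0. Qed.

Lemma F_refl : \rank (mon Fs (Alpha ord0) - 1%:M)%R = 1%N /\ \det (mon Fs (Alpha ord0)) = eta1.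
Proof.
have [x [y [yx ->]]] := F_inflate.
by rewrite rank_inflateB1 // det_inflate // rank_scalarB1 // det_scalar1.
Qed.

Lemma G_refl : \rank (mon Gs (Alpha ord0) - 1%:M)%R = 1%N /\ \det (mon Gs (Alpha ord0)) = eta2.
Proof.
have [x [y [yx ->]]] := G_inflate.
by rewrite rank_inflateB1 // det_inflate // rank_scalarB1 // det_scalar1.
Qed.

Lemma zs_enum : exists2 zeta : 'I_k -> C, enum_roots e zeta & zs = [seq zeta i | i <- enum 'I_k].
Proof.
exists (fun i => zs`_i).
  split=> [i j /eqP|i].
    by rewrite nth_uniq ?szs // => /eqP/val_inj.
  by apply/eqP; rewrite -mem_zs mem_nth ?szs.
by rewrite -[LHS](mkseq_nth 0) /mkseq szs -val_enum_ord -map_comp.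
Qed.

Lemma F_coprime : coprimep (poly_of zs) (poly_of xF).
Proof. by have [_ _ _ dF] := xF_props; exact: poly_of_coprime. Qed.

Lemma G_coprime : coprimep (poly_of zG) (poly_of xG).
Proof. by have [_ _ _ dG] := xG_props; exact: poly_of_coprime. Qed.

Lemma F_irr : row_irreducible (pair_of F0 F1).
Proof. by have [sF uF _ dF] := xF_props; exact: model_irreducible. Qed.

Lemma G_irr : row_irreducible (pair_of G0 G1).
Proof.
have [sG uG _ dG] := xG_props; apply: model_irreducible => //; last exact: uniq_zG.
by rewrite size_rcons szs.
Qed.

Theorem F_system : [/\ irreducible Fs, rigid_bare Fs, pochhammer1_bare Fs &
  determined_by Fs (fun M =>
    data_bare M eps (fun=> eta1) (fun i : 'I_k => xi (wid i)) (fun=> 1%N))].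
Proof.
have [rF dF] := F_refl; have [sF uF nF xFz] := xF_props.
have ev0 : evm (mon Fs (Omega0 1)) (poly_of zs) = 0 by apply: evm_poly_of F_conj0 _.
have ev1 : evm (mon Fs (OmegaInf 1)) (poly_of xF) = 0 by apply: evm_poly_of F_conj1 _.
split.
- apply: irreducible_rows => //; apply: row_irreducible_sub F_irr => -[];
    by [exists (Omega0 1) | exists (OmegaInf 1)].
- move=> M bM.
  have [cO cD] := restriction_boundary_bare (bM (Outer 1) (fun E => ltac:(discriminate E))).
  have [cA _] := restriction_boundary_bare (bM (Blade ord0) (fun E => ltac:(discriminate E))).
  have cM := conjugate_trans cO F_conj1.
  apply: F_unique; first by rewrite (conjugate_size cM).
  + exact: cD.
  + exact: evm_poly_of cM _.
  by rewrite (conjugate_rankB1 cA) rF.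
- apply: (@pochhammer_bare_intro _ _ _ _ Fs eps _ _ k0 eps0 erefl F_coprime ev0 ev1); last by rewrite muln1.
  by move=> i; rewrite ord1.
split.
  have [zeta zetaE zsz] := zs_enum; split=> //.
  - by move=> i; apply/pseudo_reflectionE; rewrite ?eta1_neq0 // ord1.
  - by exists zeta => //; rewrite with_mult1 -zsz; exact: F_conj0.
  - by move=> i j /xi_inj/(congr1 val) /= ij; exact: val_inj.
  by rewrite with_mult1; exact: F_conj1.
move=> M [Md Ma _ _]; rewrite with_mult1 -/xF => cM.
have [rA _] := (proj1 (pseudo_reflectionE _ eta1_neq0 eta1_1)) (Ma ord0).
apply: F_unique => //; first by rewrite (conjugate_size cM).
  exact: evm_poly_of cM _.
by rewrite rA.
Qed.

Lemma evm_zG n (A : 'M[C]_n) s : conjugate A (diag_of s) ->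
  (forall x, x \in s -> x = b \/ x ^+ k = e) -> evm A (poly_of zG) = 0.
Proof.
move=> cA sP; apply: evm_poly_of cA _ => x /sP xP; rewrite mem_rcons inE mem_zs.
by case: xP => ->; rewrite eqxx ?orbT.
Qed.

Theorem G_system : [/\ irreducible Gs, rigid_shaft Gs, pochhammer1_shaft k r Gs &
  determined_by Gs (fun M => data_shaft k r M eps b (fun=> eta2) xi (fun=> 1%N))].
Proof.
have [rG dG] := G_refl; have [sG uG nG xGz] := xG_props.
have ev0 : evm (mon Gs (Omega0 1)) (poly_of zG) = 0 by apply: evm_poly_of G_conj0 _.
have ev1 : evm (mon Gs (OmegaInf 1)) (poly_of xG) = 0 by apply: evm_poly_of G_conj1 _.
(* Among the eigenvalues of [Omega0], only [b] is not a [k]-th root of [eps^r]. *)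
have r1 : \rank (mon Gs (Omega0 1) ^+ k - e%:M)%R = 1%N.
  rewrite -pow_of_evm (conjugate_rank_evm _ G_conj0) -cats1 count_cat /= zsE !hornerE.
  rewrite subr_eq0 bk (_ : count _ _ = 0%N) //; apply/eqP; rewrite eqn0Ngt -has_count.
  by apply/hasPn => x; rewrite mem_zs !hornerE subr_eq0 negbK.
have rkG : rank Gs = (1 + k * \sum_(i < 1) \rank (mon Gs (Alpha i) - 1%:M)%R)%N.
  by rewrite big_ord1 rG muln1.
split.
- apply: irreducible_rows => //; apply: row_irreducible_sub G_irr => -[];
    by [exists (Omega0 1) | exists (OmegaInf 1)].
- move=> M bM.
  have [cO cD] := restriction_boundary_shaft (bM (Outer 1)).
  have [cI _] := restriction_boundary_shaft (bM (Inner 1)).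
  have [cA _] := restriction_boundary_shaft (bM (Blade ord0)).
  have cM := conjugate_trans cO G_conj1; have cM0 := conjugate_trans cI G_conj0.
  apply: G_unique; first by rewrite (conjugate_size cM).
  + exact: cD.
  + exact: evm_poly_of cM0 _.
  + exact: evm_poly_of cM _.
  by rewrite (conjugate_rankB1 cA) rG.
- split; first exact: (@pochhammer_shaft_intro _ _ _ _ Gs eps _ _ k0 eps0 erefl G_coprime ev0 ev1 r1 rkG).
  case=> [[i j]|]; last exact: etrans (codim_alpha0_loop k r (L := Gs) erefl) r1.
  by apply: etrans (codim_blade_loop _ _ _) _; rewrite ord1.
split.
  have [zeta zetaE zsz] := zs_enum; split=> //.
  - by move=> i; apply/pseudo_reflectionE; rewrite ?eta2_neq0 // ord1.
  - by exists zeta => //; rewrite with_mult1 -zsz; exact: G_conj0.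
  by rewrite with_mult1; exact: G_conj1.
move=> M [Md Ma [zeta [_ zetaE] cM0] _]; rewrite with_mult1 -/xG => cM.
have [rA _] := (proj1 (pseudo_reflectionE _ eta2_neq0 eta2_1)) (Ma ord0).
apply: G_unique => //; first by rewrite (conjugate_size cM).
- apply: evm_zG cM0 _ => x; rewrite mem_rcons inE => /orP[/eqP|]; first by left.
  by case/mem_with_mult=> i ->; right.
- exact: evm_poly_of cM _.
by rewrite rA.
Qed.


(** * The sum of [m] copies of F and one copy of G *)

Definition model_system : local_system C turbine_shaft_bullet :=
  dsum (restriction (forget_map C k r 1) (dsum_pow Fs m)) Gs.
Local Notation L1 := model_system.
Local Notation Delta0 := (block_mx eta2%:M 0 0 eta1%:M : 'M[C]_(1 + m)).

Lemma mon_model g : mon L1 g = block_mx (mon (dsum_pow Fs m) g) 0 0 (mon Gs g).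
Proof. by rewrite /= expr1 mulmx1. Qed.

Lemma rank_model : rank L1 = (m * k + k.+1)%N.
Proof. by rewrite /= rank_dsum_pow. Qed.

Lemma mon_model_delta : mon L1 (Delta 1) = eps%:M.
Proof. by rewrite mon_model (@mon_dsum_pow_scalar _ _ Fs m (Delta 1) eps) // -scalar_mx_block. Qed.

Lemma conjugate_model0 (zeta : 'I_k -> C) : zs = [seq zeta i | i <- enum 'I_k] ->
  conjugate (mon L1 (Omega0 1)) (diag_of (rcons (with_mult zeta (fun=> m.+1)) b)).
Proof.
move=> zsz; rewrite mon_model.
apply: conjugate_diag_cat (conjugate_dsum_pow m F_conj0) G_conj0 _.
rewrite -!cats1 catA perm_cat2r; apply/seq.permP => a.
rewrite count_with_mult count_cat count_flatten map_nseq sumn_nseq -mulnSr.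
rewrite zsz -with_mult1.
rewrite count_with_mult big_distrl /=.
by apply: eq_bigr => i _; rewrite muln1.
Qed.

Lemma conjugate_model1 : conjugate (mon L1 (OmegaInf 1))
  (diag_of (with_mult xi (fun j => if j == ord_max then 1%N else m.+1))).
Proof.
rewrite mon_model; apply: conjugate_diag_cat (conjugate_dsum_pow m F_conj1) G_conj1 _.
apply/seq.permP => a; rewrite count_with_mult count_cat count_flatten map_nseq sumn_nseq.
rewrite /xG -with_mult1 /xF -[X in _ = (count a X * _ + _)%N]with_mult1 !count_with_mult.
rewrite !big_ord_recr /= eqxx addnA; congr (_ + _)%N.
rewrite big_distrl -big_split /=; apply: eq_bigr => i _.
by rewrite -val_eqE /= (ltn_eqF (ltn_ord i)) !muln1 -mulnSr.
Qed.

(** With [y] fixed this is linear in [v]: recombining the generators of copies of [F] recombines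
    their eigenvectors in the same way. *)
Lemma krylov_linear d N (y : 'rV[C]_d) (A : 'M[C]_N) v :
  y *m krylov d A v = v *m \sum_i y 0 i *: A ^+ i.
Proof.
rewrite mulmx_sum_row mulmx_sumr; apply: eq_bigr => i _.
by rewrite rowK scalemxAr.
Qed.

(* The row [y] spans the image of the pseudo-reflection, hence is an eigenvector for [a]; this is
   written without inverting [B], as [y A0 = a y B0], and pushed forward along [phi]. *)
Lemma pseudo_eigen d N (x : 'cV[C]_d) (y : 'rV_d) (A0 B0 : 'M_d) a (A B : 'M_N) (phi : 'M_(d, N)) :
  y *m x = 1%:M -> B0 \in unitmx -> A0 *m invmx B0 = inflate x y a%:M ->
  A0 *m phi = phi *m A -> B0 *m phi = phi *m B -> y *m phi *m A = a *: (y *m phi *m B).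
Proof.
move=> yx uB E Aphi Bphi; rewrite -[LHS]mulmxA -Aphi mulmxA.
have -> : y *m A0 = a *: (y *m B0).
  by rewrite -[A0](mulmxKV uB) E mulmxA inflate_row // mul_scalar_mx -scalemxAl.
by rewrite -scalemxAl -mulmxA Bphi mulmxA.
Qed.

(* A copy of [G] in the pair [(A, B)] is generated by a vector [w] with [w A^j = w B^j] for
   [j <= k]: these are [k (m + 1)] linear conditions in dimension [k (m + 1) + 1].  A copy of [F] is
   generated by a [v] with [v A^j = v B^j] for [j <= k - 1] that is killed by the two annihilating
   polynomials of [F], each of rank one: this leaves a space of dimension at least [m]. *)
Lemma model_lift : exists (D0 : 'M[C]_(rank L1, 1 + m)) (Y0 : 'M[C]_(1 + m, rank L1)),
  [/\ Y0 *m D0 = 1%:M, mon L1 (Alpha ord0) = inflate D0 Y0 Delta0 &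
  forall N (A B : 'M[C]_N), N = (m * k + k.+1)%N -> B \in unitmx ->
    evm A (poly_of zG) = 0 -> evm B (poly_of xG) = 0 -> (\rank (A - B)%R <= m.+1)%N ->
    (\rank (evm A (poly_of zs)) <= 1)%N -> (\rank (evm B (poly_of xF)) <= 1)%N ->
    liftable Y0 A B].
Proof.
have [xf [yf [yxf aF]]] := F_inflate; have [xg [yg [yxg aG]]] := G_inflate.
pose Yp := diag_rows (F := Fs) m yf; pose Dp := diag_cols (F := Fs) m xf.
have YDp : Yp *m Dp = 1%:M by exact: (diag_rows_cols (F := Fs)).
(* [Delta0] lists [eta2], that is [G], first, whereas [G] is the last summand of [L1]: hence the
   antidiagonal blocks. *)
exists (block_mx 0 Dp xg 0), (block_mx 0 yg Yp 0); split.
- by rewrite mulmx_block !mulmx0 !mul0mx !addr0 !add0r yxg YDp -scalar_mx_block.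
- rewrite mon_model (mon_dsum_pow_inflate (F := Fs) m aF) aG /inflate.
  have -> : Delta0 - 1%:M = block_mx (eta2%:M - 1%:M) 0 0 (eta1%:M - 1%:M).
    by rewrite (@scalar_mx_block _ 1 m) opp_block_mx add_block_mx !oppr0 !addr0.
  rewrite !mulmx_block !mulmx0 !mul0mx !addr0 !add0r.
  by rewrite [X in _ = X + _](@scalar_mx_block _ (rank (dsum_pow Fs m)) k.+1) add_block_mx !mul0mx !addr0.
move=> N A B NE uB Ap Bq rAB rA rB.
have [sF uF nF dF] := xF_props; have [sG uG nG dG] := xG_props.
have sz : size zG = k.+1 by rewrite size_rcons szs.
have [|psi fpsi [psi0 psi1]] := model_embedding (ltn0Sn k) sz sG uniq_zG uG dG Ap Bq rAB.
  by rewrite NE /=; lia.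
have [|E rE EK] := @common_kernel _ N k.-1 (fun j => A ^+ j *m (A - B)) m.+1.
  by move=> j; exact: leq_trans (mxrankM_maxr _ _) rAB.
pose E' := (E :&: kermx (evm A (poly_of zs)) :&: kermx (evm B (poly_of xF)))%MS.
have rE' : (m <= \rank E')%N.
  have := mxrank_mul_ker E (evm A (poly_of zs)).
  have := mxrank_mul_ker (E :&: kermx (evm A (poly_of zs)))%MS (evm B (poly_of xF)).
  have := leq_trans (mxrankM_maxr E _) rA.
  have := leq_trans (mxrankM_maxr (E :&: kermx (evm A (poly_of zs)))%MS _) rB.
  have km : (k.-1 * m.+1 + m.+1 = m * k + k)%N.
    by rewrite addnC -mulSn prednK // mulnS addnC mulnC.
  rewrite -/E'; move: rE NE km; lia.
have [V fV VE'] : exists2 V : 'M[C]_(m, N), row_free V & (V <= E')%MS.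
  exists (pid_mx m *m row_base E').
    by rewrite /row_free mxrankMfree ?row_base_free // rank_pid_mx.
  by rewrite (submx_trans (submxMl _ _)) // eq_row_base.
have intw (w : 'rV_N) : (w <= V)%MS ->
    F0 *m krylov k A w = krylov k A w *m A /\ F1 *m krylov k A w = krylov k A w *m B.
  move=> wV; have := submx_trans wV VE'; rewrite !sub_capmx.
  case/andP=> [/andP[wE /sub_kermxP w0] /sub_kermxP w1].
  apply: krylov_intertwined; rewrite ?monic_prod_XsubC ?size_prod_XsubC ?szs ?sF // => j jk.
  by have /submxP[X ->] := wE; rewrite -mulmxA EK // mulmx0.
(* [Z] recombines the generators of the copies of [F], and [z] rescales the embedding of [G]. *)
pose S (Z : 'M_m) := stack (F := Fs) (fun a => krylov k A (row a (Z *m V))).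
pose P (z : C) Z := col_mx (S Z) (z *: psi).
have rowV (Z : 'M_m) a : (row a (Z *m V) <= V)%MS by rewrite row_mul submxMl.
have PI (z : C) Z : mon L1 (Omega0 1) *m P z Z = P z Z *m A /\
                    mon L1 (OmegaInf 1) *m P z Z = P z Z *m B.
  split; rewrite mon_model mul_block_col !mul0mx addr0 add0r mul_col_mx
    -[_ *m (z *: psi)]scalemxAr -[z *: psi *m _]scalemxAl ?psi0 ?psi1; congr col_mx.
    apply: (stack_intertwined (F := Fs) (g := Omega0 1)) => a.
    by have [] := intw _ (rowV Z a).
  apply: (stack_intertwined (F := Fs) (g := OmegaInf 1)) => a.
  by have [] := intw _ (rowV Z a).
pose Kr := \sum_(i < k) yf 0 i *: A ^+ i.
have YP (z : C) Z : block_mx 0 yg Yp 0 *m P z Z = col_mx (z *: (yg *m psi)) (Z *m V *m Kr).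
  rewrite mul_block_col !mul0mx addr0 add0r -scalemxAr; congr col_mx.
  by rewrite (diag_rows_stack (F := Fs)); apply/row_matrixP => a; rewrite rowK krylov_linear [RHS]row_mul.
exists (P 1 1%:M); have [P0 P1] := PI 1 1%:M; split=> //; last first.
  move=> z Z; exists (P (z 0 0) Z); have [PZ0 PZ1] := PI (z 0 0) Z; split=> //.
  rewrite !YP mul_block_col !mul0mx addr0 add0r scale1r mul1mx -!mulmxA.
  by rewrite {2}[z]mx11_scalar mul_scalar_mx.
(* A relation has a part with eigenvalue [eta2] and one with [eta1], which vanish separately. Then
   [c = 0] because [psi] is injective, and [w = 0] because [w V] would otherwise generate a copy of
   [F] in which the row [yf] is killed. *)
rewrite YP scale1r mul1mx; apply: inj_row_free => u.
rewrite -[u]hsubmxK mul_row_col; move: (lsubmx u) (rsubmx u) => c w.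
have eG := pseudo_eigen yxg (model1_unit sG uG nG) aG psi0 psi1.
rewrite [c]mx11_scalar mul_scalar_mx; move: (c 0 0) => {}c; rewrite mulmxA => cw.
have wV : (w *m V <= V)%MS by rewrite submxMl.
have [w0 w1] := intw _ wV.
have eF := pseudo_eigen yxf (model1_unit sF uF nF) aF w0 w1.
rewrite krylov_linear -/Kr in eF.
have yg0 : yg *m psi != 0.
  rewrite mulmx_free_eq0 //; apply: contra_neq (oner_neq0 C) => y0.
  by have /matrixP/(_ 0 0) := yxg; rewrite y0 mul0mx !mxE eqxx.
have c0 : c = 0.
  apply/eqP; have : (eta2 - eta1) * c == 0.
    suff : ((eta2 - eta1) * c) *: (yg *m psi) == 0 by rewrite scaler_eq0 (negPf yg0) orbF.
    rewrite -(inj_eq (can_inj (mulmxK uB))) mul0mx -scalemxAl mulrBl scalerBl.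
    have := congr1 (mulmx^~ A) cw; rewrite /= mulmxDl mul0mx -scalemxAl eG eF => E1.
    have := congr1 (fun M => eta1 *: (M *m B)) cw; rewrite /= mulmxDl mul0mx scaler0 -scalemxAl => E2.
    rewrite -[X in _ == X](subrr 0) -{1}E1 -E2 scalerDr !scalerA opprD addrACA subrr addr0.
    by rewrite mulrC [c * _]mulrC.
  by rewrite mulf_eq0 subr_eq0 eq_sym (negPf eta12).
move: cw; rewrite c0 scale0r add0r => wK.
suff : w *m V = 0 by move/eqP; rewrite mulmx_free_eq0 // => /eqP ->; rewrite raddf0 row_mx0.
apply/eqP/negPn/negP => wV0.
have kf : row_free (krylov k A (w *m V)).
  apply: row_irreducible_free (pair_of A B) _ F_irr _ _; first by case.
  apply: contraNneq wV0 => /(congr1 (row (Ordinal k0))).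
  by rewrite rowK expr0 row0 => /(etrans (esym (mulmx1 _))) ->.
have : yf *m krylov k A (w *m V) == 0 by rewrite krylov_linear wK.
rewrite mulmx_free_eq0 // => /eqP y0; have /matrixP/(_ 0 0) := yxf.
by rewrite y0 mul0mx !mxE eqxx => /esym/eqP; rewrite oner_eq0.
Qed.


Lemma conjugate_diagonalizable n (A : 'M[C]_n) s : conjugate A (diag_of s) -> diagonalizable A.
Proof.
move=> cA; have sn : size s = n by rewrite -(conjugate_size cA).
case: _ / sn in A cA *; have [P [fP uP APD]] := cA.
have uP' : P \in unitmx by rewrite -row_free_unit.
exists (invmx P); first by rewrite unitmx_inv.
apply/similar_diagP; first by rewrite unitmx_inv.
move=> i j ij; rewrite invmxK -mulmxA APD mulKmx // !mxE.
by rewrite -val_eqE (negPf ij).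
Qed.

Lemma sum_min1 l (F : 'I_l -> nat) : (\sum_i F i = l)%N -> (forall i, (1 <= F i)%N) ->
  forall i, F i = 1%N.
Proof.
move=> sF F1; have [_] := leqif_sum (fun i (_ : true) => leqif_eq (F1 i)).
rewrite sum1_card card_ord sF eqxx => /esym/forallP E i.
by apply/eqP; rewrite eq_sym; exact: E i.
Qed.

Lemma rank_prodB1 l n (A : 'I_l -> 'M[C]_n) : (forall i, (\rank (A i - 1%:M)%R <= 1)%N) ->
  (\rank (\prod_(i <- enum 'I_l) A i - 1%:M)%R <= l)%N.
Proof.
move=> rA; have /fin_all_exists[f fE] i : exists f : 'rV[C]_n, (A i - 1%:M <= f)%MS.
  by have [u [f ->]] := rank_le1 (rA i); exists f; exact: submxMl.
have AF : (\prod_(i <- enum 'I_l) A i - 1%:M <= \matrix_i f i)%MS.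
  apply: prod_sub1_rows => i; apply: submx_trans (fE i) _.
  by rewrite -[f i](rowK f) row_sub.
exact: leq_trans (mxrankS AF) (rank_leq_row _).
Qed.

(** * The extension of the sum through the disc system *)

Section Gluing.
Variables (lam : 'I_m.+1 -> C) (A0 : 'I_m.+1 -> 'M[C]_(1 + m)).
Hypotheses (lam0 : forall i, lam i != 0) (lam1 : forall i, lam i != 1).
Hypotheses (rA0 : forall i, \rank (A0 i - 1%:M)%R = 1%N) (dA0 : forall i, \det (A0 i) = lam i).
Hypotheses (pA0 : \prod_(i <- enum 'I_m.+1) A0 i = Delta0) (iA0 : row_irreducible A0).
Hypothesis uA0 : forall A : 'I_m.+1 -> 'M[C]_(1 + m),
  (forall i, (\rank (A i - 1%:M)%R <= 1)%N) -> (forall i, \det (A i) = lam i) ->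
  (\rank (\prod_(i <- enum 'I_m.+1) A i - eta1%:M)%R <= 1)%N ->
  exists2 Z : 'M[C]_(1 + m), Z \in unitmx & forall i, Z *m A i = A0 i *m Z.

Lemma disc_rep : is_representation (X := disc_section m.+1) A0.
Proof. by split=> // i; rewrite unitmxE dA0 unitfE. Qed.

Definition Lt : local_system C (disc_section m.+1) := LocalSystem disc_rep.

Lemma disc_unique (M : local_system C (disc_section m.+1)) :
  rank M = m.+1 -> (forall i, (\rank (mon M i - 1%:M)%R <= 1)%N) ->
  (forall i, \det (mon M i) = lam i) ->
  (\rank (\prod_(i <- enum 'I_m.+1) mon M i - eta1%:M)%R <= 1)%N -> isomorphic M Lt.
Proof.
case: M => d rho rhoP /= /esym E; case: _ / E in rho rhoP * => rM dM pM.
have [Z uZ ZE] := uA0 rM dM pM; apply: isomorphic_sym; exists Z.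
by rewrite row_free_unit row_full_unit uZ; split=> // i; rewrite /= ZE.
Qed.

Lemma conjugate_Delta0 : conjugate Delta0 (diag_of (rcons (nseq m eta1) eta2)).
Proof.
apply: (@conjugate_diag_cat _ 1 m _ _ [:: eta2] (nseq m eta1)); last by rewrite perm_rcons perm_refl.
  by rewrite -diag_const_mx; apply: conjugate_diag_perm; rewrite enum_ordSl enum_ord0 /= mxE.
rewrite -diag_const_mx; apply: conjugate_diag_perm.
have /all_pred1P-> : all (pred1 eta1) [seq (const_mx eta1 : 'rV_m) 0 i | i <- enum 'I_m].
  by rewrite all_map; apply/allP => i _; rewrite /= mxE.
by rewrite size_map size_enum_ord.
Qed.

Lemma rank_conjugate_eta n (A : 'M[C]_n) : conjugate A (diag_of (rcons (nseq m eta1) eta2)) ->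
  (\rank (A - eta1%:M)%R <= 1)%N.
Proof.
move=> cA; have := conjugate_rank_evm ('X^1 - eta1%:P) cA.
rewrite evm_XnsubC // expr1 => ->; rewrite -cats1 count_cat count_nseq /= !hornerE subrr eqxx.
by rewrite mul0n; case: (_ != 0).
Qed.

Theorem disc_theorem : [/\ irreducible Lt, rigid_disc Lt, pochhammer1_domain Lt &
  determined_by Lt (fun M => data_disc M lam eta1 eta2)].
Proof.
split.
- exact: irreducible_rows.
- move=> M bM.
  have cM i : conjugate (mon M i) (A0 i).
    have [P [fP uP PE]] := bM (Some i); exists P; split=> //.
    by have := PE tt; rewrite /= !expr1 !mulmx1.
  have cP : conjugate (\prod_(i <- enum 'I_m.+1) mon M i) Delta0.
    have [P [fP uP PE]] := bM None; exists P; split=> //.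
    by have := PE tt; rewrite /= !eval_word_alpha_prod pA0.
  apply: disc_unique.
  + by have [P [fP uP _]] := cP; exact: row_free_full_eq fP uP.
  + by move=> i; rewrite (conjugate_rankB1 (cM i)) rA0.
  + by move=> i; have [P [fP uP /(det_intertwined fP uP)->]] := cM i.
  exact: rank_conjugate_eta (conjugate_trans cP conjugate_Delta0).
- have c1 i : codim (fixed_mx (mon Lt i)) = 1%N by rewrite codim_fixed rA0.
  split=> //; split; first by rewrite (eq_bigr (fun=> 1%N)) // sum1_card card_ord.
  apply/andP; split; last exact: sub0mx.
  set U := (\bigcap_i _)%MS.
  have VF i : A0 i *m U^T = U^T by apply/(sub_fixed (mon Lt i)); apply: bigcapmx_inf (submx_refl _).
  suff U0 : U^T = 0 by rewrite -[U]trmxK U0 trmx0 sub0mx.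
  (* A common fixed vector is fixed by the product, which does not have the eigenvalue 1. *)
  have := prod_fixed (enum 'I_m.+1) VF; rewrite pA0 => /eqP; rewrite -subr_eq0 -{2}[U^T]mul1mx -mulmxBl.
  have uD : Delta0 - 1%:M \in unitmx.
    rewrite (@scalar_mx_block _ 1 m) opp_block_mx add_block_mx !oppr0 !addr0 -!raddfB.
    by rewrite block_diag_mx_unit !unitmxE !det_scalar !unitrX ?unitfE ?subr_eq0.
  by move=> /eqP E; rewrite -[U^T](mulKmx uD) E mulmx0.
split.
  split=> // [i|]; first exact/pseudo_reflectionE.
  by rewrite eval_word_alpha_prod pA0; exact: conjugate_Delta0.
move=> M [rM Ma cM]; rewrite eval_word_alpha_prod in cM.
have rdM i := proj1 (pseudo_reflectionE _ (lam0 i) (lam1 i)) (Ma i).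
apply: disc_unique => // [i|i|]; [by have [->] := rdM i | by have [] := rdM i |].
exact: rank_conjugate_eta cM.
Qed.

Variables (D0 : 'M[C]_(rank L1, 1 + m)) (Y0 : 'M[C]_(1 + m, rank L1)).
Hypotheses (YD : Y0 *m D0 = 1%:M) (L1a : mon L1 (Alpha ord0) = inflate D0 Y0 Delta0).
Hypothesis lift : forall N (A B : 'M[C]_N), N = (m * k + k.+1)%N -> B \in unitmx ->
    evm A (poly_of zG) = 0 -> evm B (poly_of xG) = 0 -> (\rank (A - B)%R <= m.+1)%N ->
    (\rank (evm A (poly_of zs)) <= 1)%N -> (\rank (evm B (poly_of xF)) <= 1)%N ->
    liftable Y0 A B.

Definition glued_system : local_system C (turbine_shaft m.+1) :=
  extension_system YD eps0 L1a lam0 dA0 pA0.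
Local Notation L := glued_system.

Lemma conjugate_model0_facts n (A : 'M[C]_n) : conjugate A (mon L1 (Omega0 1)) ->
  [/\ n = rank L1, evm A (poly_of zG) = 0 & \rank (evm A (poly_of zs)) = 1%N].
Proof.
move=> cA; have [zeta [_ zetaE] zsz] := zs_enum.
have {}cA := conjugate_trans cA (conjugate_model0 zsz).
have mz i : zeta i \in zs by rewrite mem_zs zetaE.
split.
- rewrite (conjugate_size cA) rank_model size_rcons size_with_mult sum_nat_const card_ord.
  by rewrite mulnS addnS addnC mulnC.
- apply: evm_zG cA _ => x; rewrite mem_rcons inE => /orP[/eqP|]; first by left.
  by case/mem_with_mult=> i ->; right.
rewrite (conjugate_rank_evm _ cA) -cats1 count_cat count_with_mult /= big1 ?add0n ?addn0.
  by rewrite -rootE root_prod_XsubC (negPf b_zs).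
by move=> i _; rewrite -rootE root_prod_XsubC mz.
Qed.

Lemma conjugate_model1_facts n (A : 'M[C]_n) : conjugate A (mon L1 (OmegaInf 1)) ->
  evm A (poly_of xG) = 0 /\ (\rank (evm A (poly_of xF)) <= 1)%N.
Proof.
move=> cA; have {}cA := conjugate_trans cA conjugate_model1; split.
  apply: evm_poly_of cA _ => x /mem_with_mult[i ->].
  by apply: map_f; rewrite mem_enum.
rewrite (conjugate_rank_evm _ cA) count_with_mult big_ord_recr /= eqxx muln1 big1 ?add0n ?leq_b1 //.
move=> i _; rewrite -rootE root_prod_XsubC map_f //; exact: mem_enum.
Qed.

(** Shared by rigidity and by the uniqueness of the extension. The spectra supply the polynomials
    and ranks that [lift] asks for, and the number of reflections bounds the rank of
    [Omega0 - OmegaInf]. *)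
Lemma glued_unique (M : local_system C (turbine_shaft m.+1)) :
  conjugate (mon M (Omega0 _)) (mon L1 (Omega0 1)) ->
  conjugate (mon M (OmegaInf _)) (mon L1 (OmegaInf 1)) ->
  mon M (Delta _) = eps%:M -> (forall i, (\rank (mon M (Alpha i) - 1%:M)%R <= 1)%N) ->
  (forall i, \det (mon M (Alpha i)) = lam i) -> isomorphic M L.
Proof.
move=> c0 c1 Md Mr Mdet; apply: isomorphic_sym; have [uM _] := monP M.
have [rM ev0 r0] := conjugate_model0_facts c0; have [ev1 r1] := conjugate_model1_facts c1.
apply: (extension_unique YD eps0 L1a G_coprime) => //.
apply: lift => //; rewrite ?r0 //; first by rewrite rM rank_model.
by apply: (rank_omegaB (mon_shaft M)); exact: rank_prodB1.
Qed.

Lemma glued_rank_pow : \rank (mon L1 (Omega0 1) ^+ k - e%:M)%R = 1%N.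
Proof.
have [_ _ r1] := conjugate_model0_facts (conjugate_refl (mon L1 (Omega0 1))).
by rewrite -pow_of_evm.
Qed.

Lemma model_ev0 : evm (mon L1 (Omega0 1)) (poly_of zG) = 0.
Proof. by have [_ ->] := conjugate_model0_facts (conjugate_refl _). Qed.

Lemma model_ev1 : evm (mon L1 (OmegaInf 1)) (poly_of xG) = 0.
Proof. by have [->] := conjugate_model1_facts (conjugate_refl _). Qed.

Lemma model_pochhammer : pochhammer_shaft k r L1.
Proof.
apply: (pochhammer_shaft_intro k0 eps0 mon_model_delta G_coprime model_ev0 model_ev1 glued_rank_pow).
rewrite big_ord1 L1a rank_inflateB1 // rank_model.
have -> : \rank (Delta0 - 1%:M) = m.+1.
  rewrite (@scalar_mx_block _ 1 m) opp_block_mx add_block_mx !oppr0 !addr0.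
  by rewrite rank_diag_block_mx !rank_scalarB1.
by rewrite mulnS addnS addnC mulnC.
Qed.

Lemma glued_refl i : \rank (mon L (Alpha i) - 1%:M)%R = 1%N /\ \det (mon L (Alpha i)) = lam i.
Proof. by rewrite /= rank_inflateB1 // det_inflate. Qed.

Lemma glued_pochhammer : pochhammer1_shaft k r L.
Proof.
have cD : mon L (Delta _) = eps%:M by [].
split.
  apply: (pochhammer_shaft_intro k0 eps0 cD G_coprime model_ev0 model_ev1 glued_rank_pow).
  rewrite (eq_bigr (fun=> 1%N)) => [|i _]; last by have [] := glued_refl i.
  by rewrite sum1_card card_ord [LHS]rank_model mulnS addnS addnC mulnC.
case=> [[i j]|]; last exact: etrans (codim_alpha0_loop k r cD) glued_rank_pow.
by apply: etrans (codim_blade_loop _ _ _) _; have [] := glued_refl i.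
Qed.

Lemma glued_extension : is_extension k r L L1 Lt.
Proof.
have [_ _ [pLt _] _] := disc_theorem; have [pL _] := glued_pochhammer.
split=> //; first exact: model_pochhammer.
  exact: extension_restriction mon_model_delta _ _ _.
apply: (extension_quotient YD eps0 L1a lam0 dA0 pA0 (Lt := Lt) (Z := 1%:M)).
- by rewrite row_free_unit unitmx1.
- by rewrite row_full_unit unitmx1.
by move=> i; rewrite mulmx1 mul1mx.
Qed.

(** By dimension, the row space of [Q] equals its double annihilator. *)
Lemma sub_rowspace_ker n n' (Q : 'M[C]_(n', n)) (R0 : 'M[C]_n) :
  kermx Q^T *m R0^T = 0 -> (R0 <= Q)%MS.
Proof.
move=> KR; pose K := kermx Q^T.
have QK : (Q <= kermx K^T)%MS.
  by apply/sub_kermxP; apply: trmx_inj; rewrite trmx_mul trmxK mulmx_ker trmx0.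
have KQ : (kermx K^T <= Q)%MS.
  rewrite -(mxrank_leqif_sup QK) mxrank_ker mxrank_tr mxrank_ker mxrank_tr.
  by rewrite subKn ?rank_leq_col.
apply: submx_trans KQ; apply/sub_kermxP; apply: trmx_inj.
by rewrite trmx_mul trmxK KR trmx0.
Qed.

(** The quotient fixes the determinants [lam i], which differ from 1, so each [alpha_i - 1] has rank
    at least one; the Pochhammer count makes these ranks add up to [m + 1], so all are one. *)
Lemma glued_extension_unique (M : local_system C (turbine_shaft m.+1)) : is_extension k r M L1 Lt ->
  isomorphic M L.
Proof.
case=> [[rkM _] _ _ [P [fP uP PE]] [K cK [Q [QE fQ kQ]]]].
have PO : mon M (Omega0 _) *m P = P *m mon L1 (Omega0 1).
  by have := PE (Omega0 1); rewrite [mon (restriction _ _) _]eval_word1.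
have PI : mon M (OmegaInf _) *m P = P *m mon L1 (OmegaInf 1).
  by have := PE (OmegaInf 1); rewrite [mon (restriction _ _) _]eval_word1.
have cO : conjugate (mon M (Omega0 _)) (mon L1 (Omega0 1)) by exists P.
have cI : conjugate (mon M (OmegaInf _)) (mon L1 (OmegaInf 1)) by exists P.
have MD : mon M (Delta _) = eps%:M.
  have [P' [fP' uP' P'E]] := conjugate_sym (ex_intro _ P (And3 fP uP (PE (Delta 1)))).
  move: P'E; rewrite [mon (restriction _ _) _]eval_word1 mon_model_delta.
  exact: scalar_intertwined uP'.
have [rM _ r1] := conjugate_model0_facts cO.
have sr : (\sum_i \rank (mon M (Alpha i) - 1%:M)%R = m.+1)%N.
  have E : (rank M = 1 + k * \sum_i \rank (mon M (Alpha i) - 1%:M)%R)%N.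
    by apply: etrans rkM _; rewrite (codim_line_shaft k r MD) -pow_of_evm r1.
  have : (k * \sum_i \rank (mon M (Alpha i) - 1%:M)%R = k * m.+1)%N.
    by move: E (etrans rM rank_model); rewrite mulnS (mulnC k m); lia.
  by move/eqP; rewrite eqn_pmul2l // => /eqP.
have QA i : Q *m mon M (Alpha i) = A0 i *m Q.
  by have := QE i; rewrite [mon (restriction _ _) _]eval_word1.
(* [alpha_i - 1] kills the constant subsystem, the kernel of [Q], hence factors through [Q]. *)
have XQ i : exists X, mon M (Alpha i) - 1%:M = X *m Q.
  apply/submxP/sub_rowspace_ker.
  have KF : (kermx Q^T <= fixed_mx (mon M (Alpha i)))%MS.
    by rewrite kQ; have := cK i; rewrite [mon (restriction _ _) _]eval_word1.
  by apply/sub_kermxP.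
have MA i : \det (mon M (Alpha i)) = lam i.
  have [X XE] := XQ i.
  have ME : mon M (Alpha i) = 1%:M + X *m Q by rewrite -XE addrC subrK.
  (* [1 + Q X] is the action [A0 i] on the quotient. *)
  rewrite ME det_1D_mulC -dA0; congr (\det _); apply: (row_free_inj fQ).
  by rewrite -QA ME mulmxDl mulmxDr mul1mx mulmx1 mulmxA.
have M1 := sum_min1 sr.
apply: glued_unique => // i; rewrite M1 // => {}i.
rewrite lt0n mxrank_eq0 subr_eq0; apply: contraNneq (lam1 i) => E.
by rewrite -MA E det1.
Qed.

Theorem glued_theorem :
  [/\ data_shaft k r L eps b lam xi (fun j => if j == ord_max then 1%N else m.+1),
      [/\ irreducible L, rigid_shaft L & pochhammer1_shaft k r L],
      semisimple_at_infinity L, is_extension k r L L1 Lt &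
      forall M, is_extension k r M L1 Lt -> isomorphic M L].
Proof.
split.
- have [zeta zetaE zsz] := zs_enum; split=> //.
  + by move=> i; apply/pseudo_reflectionE => //; exact: glued_refl.
  + by exists zeta => //; exact: conjugate_model0.
  exact: conjugate_model1.
- split; last exact: glued_pochhammer.
    exact: extension_irreducible G_coprime model_ev0 model_ev1 _ _ _ iA0.
  move=> M bM.
  have [cO cD] := restriction_boundary_shaft (bM (Outer _)).
  have [cI _] := restriction_boundary_shaft (bM (Inner _)).
  have cA i := proj1 (restriction_boundary_shaft (bM (Blade i))).
  apply: glued_unique => //; first exact: cD.
    by move=> i; rewrite (conjugate_rankB1 (cA i)); have [->] := glued_refl i.
  by move=> i; have [P [fP uP /(det_intertwined fP uP)->]] := cA i; have [] := glued_refl i.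
- exact: conjugate_diagonalizable conjugate_model1.
- exact: glued_extension.
exact: glued_extension_unique.
Qed.

End Gluing.
End Systems.

(** Since [eta2 = eta1 b / xi_(k+1)], the Fuchs relation is the determinant condition on the disc:
    the product of the reflections has eigenvalues [eta1], taken [m] times, and [eta2]. *)
Lemma fuchs_disc_product (C : fieldType) (k m : nat) (r : int) (eps b eta1 eta2 : C)
    (lam : 'I_m.+1 -> C) (xi : 'I_k.+1 -> C) (xi0 : forall j, xi j != 0)
  (eta1E : eta1 =
     (-1) ^+ k.-1 * eps ^ r * \prod_(i < k) (xi (widen_ord (leqnSn k) i))^-1)
  (eta2E : eta2 =
     (-1) ^+ k.-1 * eps ^ r * b * \prod_(i < k.+1) (xi i)^-1)
  (fuchs : (\prod_(i < m.+1) lam i) *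
             (\prod_(i < k) xi (widen_ord (leqnSn k) i) ^+ m.+1) * xi ord_max =
           (-1) ^+ (k.-1 * m.+1) * b * eps ^ (r * m.+1%:Z)) :
  \prod_i lam i = eta1 ^+ m * eta2.
Proof.
have -> : eta2 = eta1 * (b / xi ord_max) by rewrite eta2E big_ord_recr eta1E /=; ring.
rewrite mulrA -exprSr eta1E prodfV !exprMn exprVn.
move: fuchs; rewrite prodrXl exprM -exprz_exp.
have : \prod_(i < k) xi (widen_ord (leqnSn k) i) != 0.
  by rewrite prodf_seq_neq0; apply/allP => i _; rewrite xi0.
move: (\prod_(i < k) _) (xi0 ord_max) => p x0 p0 E.
have pn : p ^+ m.+1 != 0 by rewrite expf_neq0.
apply: (mulIf pn); apply: (mulIf x0); rewrite E -exprnP.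
move: (p ^+ m.+1) pn => q q0; field.
by rewrite q0 x0.
Qed.

Theorem theorem6p4 (R : realType) (n k l : nat) (r s : int)
  (k_ge1 : (1 <= k)%N) (k_lt_n : (k < n)%N) (coprime_nk : coprime n k)
  (l_ge1 : (1 <= l)%N) (bezout : r * n%:Z = k%:Z * s + 1)
  (eps b : R[i]) (lam : 'I_l -> R[i]) (xi : 'I_k.+1 -> R[i])
  (eta1 eta2 : R[i])
  (eps_neq0 : eps != 0) (b_neq0 : b != 0)
  (lam_neq0 : forall i, lam i != 0) (xi_neq0 : forall j, xi j != 0)
  (eta1E : eta1 =
     (-1) ^+ k.-1 * eps ^ r * \prod_(i < k) (xi (widen_ord (leqnSn k) i))^-1)
  (eta2E : eta2 =
     (-1) ^+ k.-1 * eps ^ r * b * \prod_(i < k.+1) (xi i)^-1)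
  (lam_neq1 : forall i, lam i != 1) (eta1_neq1 : eta1 != 1)
  (eta2_neq1 : eta2 != 1) (lam_neq_eta1 : forall i, lam i != eta1)
  (xi_inj : injective xi) (xi_neq_b : forall j, xi j != b)
  (xi_pow : forall j, xi j ^+ k != eps ^ r) (b_pow : b ^+ k != eps ^ r)
  (xi_sum : \sum_(i < k) xi (widen_ord (leqnSn k) i) != 0)
  (eta_neq : eta1 != eta2)
  (fuchs : (\prod_(i < l) lam i) *
             (\prod_(i < k) xi (widen_ord (leqnSn k) i) ^+ l) * xi ord_max =
           (-1) ^+ (k.-1 * l) * b * eps ^ (r * l%:Z)) :
  exists (Fs : local_system R[i] (turbine_bullet k r))
         (Gs : local_system R[i] turbine_shaft_bullet)
         (Lt : local_system R[i] (disc_section l)),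
  [/\ (* (i) *)
      [/\ irreducible Fs, rigid_bare Fs, pochhammer1_bare Fs &
          determined_by Fs (fun M =>
            data_bare M eps (fun=> eta1)
              (fun i : 'I_k => xi (widen_ord (leqnSn k) i)) (fun=> 1%N))],
      (* (ii) *)
      [/\ irreducible Gs, rigid_shaft Gs, pochhammer1_shaft k r Gs &
          determined_by Gs (fun M =>
            data_shaft k r M eps b (fun=> eta2) xi (fun=> 1%N))],
      (* (iii) *)
      [/\ irreducible Lt, rigid_disc Lt, pochhammer1_domain Lt &
          determined_by Lt (fun M => data_disc M lam eta1 eta2)] &
      (* (iv) *)
      let L' := dsum (restriction (forget_map _ k r 1) (dsum_pow Fs l.-1)) Gs in
      exists L : local_system R[i] (turbine_shaft l),
        [/\ data_shaft k r L eps b lam xi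
              (fun j => if j == ord_max then 1%N else l),
            [/\ irreducible L, rigid_shaft L & pochhammer1_shaft k r L],
            semisimple_at_infinity L,
            is_extension k r L L' Lt &
            forall M, is_extension k r M L' Lt -> isomorphic M L]].
Proof.
case: l l_ge1 lam lam_neq0 lam_neq1 lam_neq_eta1 fuchs => [//|m] _ lam lam0 lam1 lam_eta fuchs.
have e0 : eps ^ r != 0 by rewrite expfz_neq0.
(* [zs] is the spectrum of [Omega0] on [F]. *)
have [zs [szs uzs zsE]] := roots_of_unity_seq k_ge1 e0.
have eta10 := eta1_neq0 k_ge1 eps_neq0 xi_neq0 szs zsE xi_inj xi_pow eta1E.
have lam_prod := fuchs_disc_product xi_neq0 eta1E eta2E fuchs.
have [A0 [rA0 dA0 pA0 iA0 uA0]] := disc_system lam1 lam_eta eta1_neq1 eta2_neq1 eta_neq eta10 lam_prod.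
have [D0 [Y0 [YD aY lift]]] := model_lift m k_ge1 eps_neq0 b_neq0 xi_neq0 szs uzs zsE
  xi_inj xi_neq_b xi_pow b_pow eta1E eta2E eta1_neq1 eta2_neq1 eta_neq.
have FP := F_system k_ge1 eps_neq0 xi_neq0 szs uzs zsE xi_inj xi_pow eta1E eta1_neq1.
have GP := G_system k_ge1 eps_neq0 b_neq0 xi_neq0 szs uzs zsE xi_inj xi_neq_b xi_pow b_pow
  eta2E eta2_neq1.
have DP := disc_theorem eta1_neq1 eta2_neq1 lam0 lam1 rA0 dA0 pA0 iA0 uA0.
have LP := glued_theorem eta1_neq1 eta2_neq1 eta_neq lam0 lam1 rA0 dA0 pA0 iA0 uA0 YD aY lift.
do 3!eexists; split; [exact FP | exact GP | exact DP |].
by eexists; exact LP.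
Qed.
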